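(* Let $r\ge 2$ be an integer, let $q$ be a power of a prime number $p$, let $K=\overline{\mathbb{F}_q}(t)$, let $\mathbf{a},\mathbf{b}\in K$ and let $\Phi:\mathbb{F}_q[t]\to \mathrm{End}_{K(z)}(\mathbb{G}_a)$ be the family of Drinfeld modules given by $$\Phi_t(x)=tx+z x^{q} + x^{q^r}.$$ Then there exist infinitely many $\lambda\in\overline{K}$ such that both $\mathbf{a}$ and $\mathbf{b}$ are torsion points for $\Phi^\lambda$ if and only if $\mathbf{a}$ and $\mathbf{b}$ are linearly dependent over $\mathbb{F}_q$.
   Context: $\overline{\mathbb{F}_q}$ is an algebraic closure of $\mathbb{F}_q$, $\overline{K}$ is an algebraic closure of $K$, and $K(z)$ is the rational function field in $z$ over $K$. For a field $L\supseteq\mathbb{F}_q(t)$, a Drinfeld $\mathbb{F}_q[t]$-module over $L$ is an $\mathbb{F}_q$-algebra homomorphism $\Phi:\mathbb{F}_q[t]\to\mathrm{End}_L(\mathbb{G}_a)$, $a\mapsto\Phi_a$ (here $\mathrm{End}_L(\mathbb{G}_a)$ is the ring of additive polynomials over $L$ in the variable $x$ under addition and composition, and $c\in\mathbb{F}_q$ acts as $\Phi_c(x)=cx$), with $\Phi_t(x)=tx+\sum_{i=1}^{r-1}a_ix^{q^i}+x^{q^r}$, $a_i\in L$; it is determined by $\Phi_t$. A point $x\in\overline{L}$ is torsion for $\Phi$ if $\Phi_a(x)=0$ for some nonzero $a\in\mathbb{F}_q[t]$. For $\lambda\in\overline{K}$, $\Phi^\lambda$ denotes the Drinfeld module obtained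 by specializing $z=\lambda$, i.e. $\Phi^\lambda_t(x)=tx+\lambda x^q+x^{q^r}$. *)

(* Defs.v *)
From HB Require Import structures.
From mathcomp Require Import all_boot all_order all_algebra all_field.
From mathcomp Require Import all_classical.

Set Implicit Arguments.
Unset Strict Implicit.
Unset Printing Implicit Defensive.

Import GRing.Theory.
Local Open Scope ring_scope.

(* The field E is algebraically closed by its type, so that f : F -> E is an  *)
(* algebraic closure as soon as it is algebraic.                              *)
Definition is_algebraic_closure (F : fieldType) (E : closedFieldType)
    (f : {rmorphism F -> E}) : Prop :=
  forall x : E, algebraicOver f x.

(* g(x + y) = g(x) + g(y) as polynomials in two variables: y is the inner and *)
(* x the outer variable of {poly {poly L}}.                                   *)
Definition additive_poly (L : fieldType) (g : {poly L}) : Prop :=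
  g^:P \Po ('X + 'X%:P) = g^:P + g%:P.

(* L is an extension of F(t) through gamma : F[t] -> L, which is required to  *)
(* be injective (generic characteristic). The ring End_L(G_a) consists of the *)
(* additive polynomials, with composition \Po as product. As F has q elements,*)
(* drinfeld_t reads Phi_t(x) = t x + \sum_(1 <= i < r) a_i x^(q^i) + x^(q^r). *)
Record drinfeldModule (F : finFieldType) (L : fieldType)
    (gamma : {rmorphism {poly F} -> L}) (r : nat) := DrinfeldModule {
  drinfeld_map :> {poly F} -> {poly L};
  drinfeld_generic : injective gamma;
  drinfeld_rank_gt0 : (0 < r)%N;
  drinfeld_additive : forall a, additive_poly (drinfeld_map a);
  drinfeldD : forall a b,
    drinfeld_map (a + b) = drinfeld_map a + drinfeld_map b;
  drinfeldM : forall a b,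
    drinfeld_map (a * b) = drinfeld_map a \Po drinfeld_map b;
  drinfeldC : forall c : F, drinfeld_map c%:P = gamma c%:P *: 'X;
  drinfeld_t : exists a : nat -> L,
    drinfeld_map 'X = gamma 'X *: 'X
      + \sum_(1 <= i < r) a i *: 'X^(#|F| ^ i) + 'X^(#|F| ^ r)
}.

Definition drinfeld_torsion (F : finFieldType) (L : fieldType)
    (gamma : {rmorphism {poly F} -> L}) (r : nat)
    (Phi : drinfeldModule gamma r) (x : L) : Prop :=
  exists2 a : {poly F}, a != 0 & root (Phi a) x.

(* Psi is obtained from Phi, defined over K(z), by the substitution           *)
(* z = lambda: the coefficients of every Phi_a lie in K[z], and Psi_a is the  *)
(* result of evaluating them at lambda.                                       *)
Definition is_specialization (F : finFieldType) (K M : fieldType)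
    (j : {rmorphism K -> M})
    (gammaKz : {rmorphism {poly F} -> {fraction {poly K}}})
    (gammaM : {rmorphism {poly F} -> M}) (r : nat) (lambda : M)
    (Phi : drinfeldModule gammaKz r) (Psi : drinfeldModule gammaM r) : Prop :=
  forall a : {poly F}, exists P : {poly {poly K}},
    Phi a = map_poly (@tofrac {poly K}) P /\
    Psi a = map_poly (horner_eval lambda \o map_poly j) P.

(* F_q[t] -> k(t), for iota : F_q -> k. *)
Definition gamma_rat (F : finFieldType) (k : fieldType)
    (iota : {rmorphism F -> k}) : {rmorphism {poly F} -> {fraction {poly k}}} :=
  @tofrac {poly k} \o map_poly iota.

(* F_q[t] -> K(z), for gamma : F_q[t] -> K. *)
Definition gamma_ratz (F : finFieldType) (K : fieldType)
    (gamma : {rmorphism {poly F} -> K}) :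
    {rmorphism {poly F} -> {fraction {poly K}}} :=
  @tofrac {poly K} \o (polyC \o gamma).

Definition gamma_ext (F : finFieldType) (K M : fieldType)
    (gamma : {rmorphism {poly F} -> K}) (j : {rmorphism K -> M}) :
    {rmorphism {poly F} -> M} :=
  j \o gamma.

(* Main.v *)
Require Import Defs.
From mathcomp Require Import all_boot all_order all_algebra all_field.
From mathcomp Require Import all_classical.
From mathcomp Require Import ring zify.

Set Implicit Arguments.
Unset Strict Implicit.
Unset Printing Implicit Defensive.

Import GRing.Theory.
Local Open Scope ring_scope.
Local Open Scope classical_set_scope.

(** The easy half. If [a] and [b] are dependent, one of them, say [a], is an
    [F]-multiple of the other, and then every torsion parameter of [b] is one of
    [a]; so it is enough that [b] has infinitely many torsion parameters. For
    [b = 0] all parameters are. For [b <> 0] and nonzero [A] in [F[t]], the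
    equation [Phi_(t A + 1)(b) = 0] is polynomial of positive degree in the
    parameter and has a root [l]; since [t A + 1] and [A] are coprime, [A] does
    not kill [b] at [l]. So no finite set exhausts the torsion parameters.

    The other half is a capacity argument. Write [phi_l(x) = t x + l x^q + x^Q]
    with [Q = q^r]. As a polynomial in [l], the iterate [phi_l^(n+1)(a)] has
    degree [Q^n] and leading coefficient [a^(q Q^n)], and its values at torsion
    parameters are bounded at every place by a constant independent of [n]
    ([torsion_bounds]). Hence the torsion parameters of [a] lie, at a place [v],
    in a set of transfinite diameter [|a|_v^(-q)], and by the product formula
    these numbers multiply to 1. If at a single place the parameters also lie in
    a set of smaller transfinite diameter, the product drops below 1 and they
    are finite in number. The proof is that of Fekete: a Vandermonde determinant
    of many parameters, computed in a basis adapted to each place, is smaller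
    than 1 somewhere and at most 1 everywhere, hence zero
    ([capacity_gap_finite]). The places are all the valuation rings of
    the algebraic closure that contain [k]; they act on the
    parameters themselves rather than on discriminants of Galois orbits, and
    the product formula becomes the fact that an element outside [k] is omitted
    by some valuation ring ([no_small_nonzero]).

    Suppose that [a] and [b] are nonzero with infinitely many common torsion
    parameters. If [b / a] had a zero or a pole on the affine line, the sets
    attached to [a] and to [b] would have different diameters there; so
    [b = c a] with [c] in [k] ([ratio_constant]). If [c^Q <> c^q], then
    [c^q phi_l(a) - phi_l(c a)] does not involve [l] and is too large at a
    well-chosen place for a combination of torsion points
    ([no_common_torsion]). If [c^Q = c^q], the combinations
    [c^(q^n) phi_l^n(a) - phi_l^n(c a)] stay bounded; when [c^q <> c] their degree
    in [l] is [Q^(n-2)] and their leading coefficients are larger at infinity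
    than those of the orbit of [a], which is once more a capacity gap
    ([constant_ratio_finite]). There remains [c^q = c], that is, [c] in [F]. *)

(** * Valuation rings over a field of constants *)

Lemma exprV_expr (E : fieldType) (x : E) i n : x != 0 -> (i <= n)%N ->
  x^-1 ^+ i * x ^+ n = x ^+ (n - i).
Proof.
move=> x0 le_in; rewrite -{1}(subnK le_in) exprD mulrCA -exprMn mulVf //.
by rewrite expr1n mulr1.
Qed.

Section ValuationRings.
Variables (k : closedFieldType) (E : fieldType) (kappa : {rmorphism k -> E}).

Record subring_over (A : set E) : Prop := SubringOver {
  subring_cst : forall c, A (kappa c);
  subringB : forall x y, A x -> A y -> A (x - y);
  subringM : forall x y, A x -> A y -> A (x * y)
}.

(** These are the places of [E] that are trivial on the constants; sizes are
    compared by divisibility in [V] rather than in a value group. *)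
Record valuation_ring (V : set E) : Prop := ValuationRing {
  valring_subring :> subring_over V;
  valring_total : forall x, V x \/ V x^-1
}.

Section Subring.
Variables (A : set E) (hA : subring_over A).

Lemma subring0 : A 0.
Proof. by have := subring_cst hA 0; rewrite rmorph0. Qed.

Lemma subring1 : A 1.
Proof. by have := subring_cst hA 1; rewrite rmorph1. Qed.

Lemma subringN x : A x -> A (- x).
Proof. by move=> Ax; rewrite -sub0r; apply: subringB => //; apply: subring0. Qed.

Lemma subringD x y : A x -> A y -> A (x + y).
Proof. by move=> Ax Ay; rewrite -[y]opprK; apply: subringB => //; apply: subringN. Qed.

Lemma subringX x n : A x -> A (x ^+ n).
Proof.
move=> Ax; elim: n => [|n IHn]; first by rewrite expr0; apply: subring1.
by rewrite exprS; apply: subringM.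
Qed.

Lemma subring_sum I (s : seq I) (P : pred I) (f : I -> E) :
  (forall i, P i -> A (f i)) -> A (\sum_(i <- s | P i) f i).
Proof. by move=> Af; apply: big_ind => //; [apply: subring0 | apply: subringD]. Qed.

Lemma subring_prod I (s : seq I) (P : pred I) (f : I -> E) :
  (forall i, P i -> A (f i)) -> A (\prod_(i <- s | P i) f i).
Proof. by move=> Af; apply: big_ind => //; [apply: subring1 | apply: (subringM hA)]. Qed.

Lemma subring_det n (M : 'M[E]_n) : (forall i j, A (M i j)) -> A (\det M).
Proof.
move=> AM; rewrite /determinant; apply: subring_sum => s _; apply: (subringM hA).
  by apply: subringX; apply: subringN; apply: subring1.
by apply: subring_prod.
Qed.

Lemma subring_horner (p : {poly E}) x :
  (forall i, A p`_i) -> A x -> A p.[x].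
Proof.
move=> Ap Ax; rewrite horner_coef; apply: subring_sum => i _.
by apply: (subringM hA) => //; apply: subringX.
Qed.

Lemma subring_map_horner (p : {poly k}) x : A x -> A (map_poly kappa p).[x].
Proof.
by move=> Ax; apply: subring_horner => // i; rewrite coef_map; apply: subring_cst.
Qed.

Definition adjoin x : set E :=
  [set y | exists2 p : {poly E}, (forall i, A p`_i) & p.[x] = y].

Lemma adjoin_subring x : subring_over (adjoin x).
Proof.
split.
- move=> c; exists (kappa c)%:P; last by rewrite hornerC.
  by move=> i; rewrite coefC; case: eqP => _; [apply: subring_cst | apply: subring0].
- move=> _ _ [p Ap <-] [p' Ap' <-]; exists (p - p'); last by rewrite !hornerE.
  by move=> i; rewrite coefB; apply: (subringB hA).
- move=> _ _ [p Ap <-] [p' Ap' <-]; exists (p * p'); last by rewrite !hornerE.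
  by move=> i; rewrite coefM; apply: subring_sum => j _; apply: (subringM hA).
Qed.

Lemma sub_adjoin x : A `<=` adjoin x.
Proof.
move=> y Ay; exists y%:P; last by rewrite hornerC.
by move=> i; rewrite coefC; case: eqP => _ //; apply: subring0.
Qed.

Lemma mem_adjoin x : adjoin x x.
Proof.
exists 'X; last by rewrite hornerX.
by move=> i; rewrite coefX; case: eqP => _; [apply: subring1 | apply: subring0].
Qed.

End Subring.

(** The union of a chain of rings that omit [y] is again one, so Zorn applies. *)
Lemma maximal_subring_avoiding (R : set E) y : subring_over R -> ~ R y ->
  exists A, [/\ subring_over A, R `<=` A, ~ A y &
    forall B, subring_over B -> A `<=` B -> ~ B y -> B `<=` A].
Proof.
move=> hR Ry.
pose good (X : set E) := subring_over (X `|` R) /\ ~ (X `|` R) y.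
have [F Fgood totF|X [[hX Xy] maxX]] := @Zorn_bigcup E good.
  set U := \bigcup_(X in F) X.
  (* two elements of the union already lie in one member of the chain *)
  have two x z : (U `|` R) x -> (U `|` R) z ->
      exists2 X, X `<=` U /\ subring_over (X `|` R) & (X `|` R) x /\ (X `|` R) z.
    have U0 : set0 `<=` U by [].
    have h0 : subring_over (set0 `|` R) by rewrite set0U.
    have sU X : F X -> X `<=` U by move=> FX w Xw; exists X.
    have hF X : F X -> subring_over (X `|` R) by move=> /Fgood[].
    case=> [[X FX Xx]|Rx] [[Z FZ Zz]|Rz].
    - have [XZ|ZX] := totF X Z FX FZ.
        by exists Z; split; [exact: sU|exact: hF|left; exact: XZ|left].
      by exists X; split; [exact: sU|exact: hF|left|left; exact: ZX].
    - by exists X; split; [exact: sU|exact: hF|left|right].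
    - by exists Z; split; [exact: sU|exact: hF|right|left].
    - by exists set0; split=> //; right.
  have lift X w : X `<=` U -> (X `|` R) w -> (U `|` R) w.
    by move=> XU [/XU Uw|Rw]; [left|right].
  split; last by case=> [[X /Fgood[_ nXy] Xy]|//]; apply: nXy; left.
  split.
  - by move=> c; right; apply: subring_cst.
  - move=> x z Ux Uz; have [X [XU hX] [Xx Xz]] := two _ _ Ux Uz.
    by apply: (lift X) => //; apply: (subringB hX).
  - move=> x z Ux Uz; have [X [XU hX] [Xx Xz]] := two _ _ Ux Uz.
    by apply: (lift X) => //; apply: (subringM hX).
exists (X `|` R); split=> //.
move=> B hB AB By; apply: contrapT => BA; apply: (maxX B).
  split; last by move=> BX; apply: BA => w /BX; left.
  by move=> w Xw; apply: AB; left.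
by rewrite /good (_ : B `|` R = B) //; apply/setUidPl => w Rw; apply: AB; right.
Qed.

Section Maximal.
Variables (A : set E) (y : E).
Hypotheses (hA : subring_over A) (y0 : y != 0) (Ay : ~ A y) (Au : A y^-1).
Hypothesis maxA : forall B, subring_over B -> A `<=` B -> ~ B y -> B `<=` A.

Let adjoin_target x : ~ A x -> adjoin A x y.
Proof.
move=> Ax; apply: contrapT => nAxy; apply: Ax.
have := maxA (adjoin_subring hA x) (@sub_adjoin _ hA x) nAxy.
by apply; apply: mem_adjoin.
Qed.

(** The inverse of [y] lies in the Jacobson radical of [A]: inverting
    [1 - w / y] cannot bring [y] into the ring, so it is already invertible. *)
Let unit_1B w : A w -> A (1 - y^-1 * w)^-1.
Proof.
move=> Aw; apply: contrapT => nA.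
set v := 1 - y^-1 * w in nA.
have v0 : v != 0.
  by apply/eqP => v0; apply: nA; rewrite v0 invr0; apply: subring0.
have [p Ap py] := adjoin_target nA.
have pow n : exists2 w', A w' & v ^+ n = 1 - y^-1 * w'.
  elim: n => [|n [w' Aw' IHn]].
    by exists 0; [apply: subring0 | rewrite mulr0 subr0].
  exists (w + w' - y^-1 * (w * w')); last by rewrite exprS IHn /v; ring.
  apply: (subringB hA); first exact: subringD.
  by apply: (subringM hA) => //; apply: (subringM hA).
have Av : A v.
  apply: (subringB hA); first exact: subring1.
  exact: (subringM hA).
have Ayv : A (y * v ^+ size p).
  rewrite -py horner_coef mulr_suml; apply: (subring_sum hA) => i _.
  rewrite -mulrA; apply: (subringM hA) => //.
  by rewrite exprV_expr // 1?ltnW //; apply: subringX.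
have [w' Aw' ew'] := pow (size p).
apply: Ay; rewrite -[y](subrK w'); apply: subringD => //.
by rewrite (_ : y - w' = y * v ^+ size p) // ew' mulrBr mulr1 mulVKf.
Qed.

(** Membership of [y] in [A[x]], with the degree recorded for a descent. *)
Let relation x n :=
  exists2 p : {poly E}, (forall i, A p`_i) /\ (size p <= n.+1)%N & y^-1 * p.[x] = 1.

(** A relation of degree [m] for [1/x] expresses [x^n] by lower powers of [x]
    with coefficients in [A / y]; substituted into a relation of degree
    [n >= m] for [x], it lowers the degree of that relation. *)
Let lower_relation x n m : x != 0 -> (m <= n)%N -> relation x n -> relation x^-1 m ->
  exists2 n', (n' < n)%N & relation x n'.
Proof.
move=> x0 le_mn [p [Ap sp] px] [b [Ab sb] bx].
have [n0|n_gt0] := posnP n.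
  case: Ay; suff -> : y = p`_0 by apply: Ap.
  move: px; rewrite (size1_polyC (leq_trans sp _)) ?n0 // hornerC coefC eqxx => e.
  by rewrite -(mulVKf y0 p`_0) e mulr1.
pose w := 1 - y^-1 * b`_0.
have w0 : w != 0.
  apply/eqP => w0; apply: Ay; suff -> : y = b`_0 by apply: Ab.
  by move/eqP: w0; rewrite subr_eq0 => /eqP e; rewrite -(mulVKf y0 b`_0) -e mulr1.
have Aw : A w^-1 by apply: unit_1B.
pose tl := \poly_(i < n) (if (n - i <= m)%N then b`_(n - i) else 0).
have Atl i : A tl`_i.
  rewrite coef_poly; case: ifP => _; last exact: subring0.
  by case: ifP => _ //; apply: subring0.
have xn : x ^+ n = y^-1 * w^-1 * tl.[x].
  have : w = y^-1 * \sum_(1 <= j < n.+1) b`_j * x^-1 ^+ j.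
    rewrite /w -{1}bx (horner_coef_wide _ (leq_trans sb (_ : (m.+1 <= n.+1)%N))) //.
    rewrite -(big_mkord xpredT (fun j => b`_j * x^-1 ^+ j)) big_ltn // expr0 mulr1.
    by rewrite mulrDr addrC addKr.
  move=> ew; apply: (mulfI w0); rewrite {1}ew.
  rewrite [RHS](_ : _ = y^-1 * tl.[x]); last by rewrite !mulrA [w * _]mulrC mulfK.
  rewrite -mulrA; congr (_ * _); rewrite mulr_suml.
  rewrite horner_poly.
  rewrite -(big_mkord xpredT
    (fun i => (if (n - i <= m)%N then b`_(n - i) else 0) * x ^+ i)).
  rewrite big_add1 /= big_nat_rev /= add0n; apply: eq_big_nat => i /andP[_ lt_in].
  rewrite subnSK // -mulrA.
  rewrite exprV_expr ?leq_subr // (subKn (ltnW lt_in)).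
  by case: ifPn => //; rewrite -ltnNge => lt_m; rewrite nth_default ?mul0r // (leq_trans sb).
exists n.-1; first by rewrite ltn_predL.
exists (take_poly n p + (p`_n * y^-1 * w^-1) *: tl).
  split.
    move=> i; rewrite coefD coefZ coef_take_poly; apply: subringD => //.
      by case: ifP => _ //; apply: subring0.
    by do !apply: (subringM hA) => //.
  rewrite prednK // (leq_trans (size_polyD _ _)) // geq_max size_take_poly.
  by rewrite (leq_trans (size_scale_leq _ _)) // size_poly.
rewrite -px; congr (_ * _); rewrite hornerD hornerZ -!mulrA [y^-1 * (_ * _)]mulrA -xn.
rewrite -[p in RHS](poly_take_drop n p) hornerD hornerM hornerXn; congr (_ + _ * _).
rewrite (@size1_polyC _ (drop_poly n p)) ?hornerC ?coef_drop_poly //.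
by rewrite size_drop_poly leq_subLR addn1.
Qed.

Let no_relations N : forall x n m, x != 0 -> (n + m <= N)%N ->
  relation x n -> relation x^-1 m -> False.
Proof.
elim: N => [|N IHN] x n m x0 le_N rx rx'.
  have [|n' lt_n'] := lower_relation x0 _ rx rx'; lia.
have [le_mn|/ltnW le_nm] := leqP m n.
  have [n' lt_n' rn'] := lower_relation x0 le_mn rx rx'.
  by apply: (IHN x n' m) => //; lia.
have x'0 : x^-1 != 0 by rewrite invr_eq0.
have rx2 : relation x^-1^-1 n by rewrite invrK.
have [m' lt_m' rm'] := lower_relation x'0 le_nm rx' rx2.
by apply: (IHN x n m') => //; lia.
Qed.

(** For [x] outside [A] and [1/x] outside [A], both [A[x]] and [A[1/x]] reach [y] by
    maximality, that is, there are relations for [x] and for [1/x]; each can be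
    used to shorten the other, without end. *)
Lemma maximal_avoiding_valuation_ring : valuation_ring A.
Proof.
split=> // x.
have [->|x0] := eqVneq x 0; first by left; apply: subring0.
have rel z : ~ A z -> exists n, relation z n.
  move=> /adjoin_target[p Ap pz]; exists (size p).
  by exists p; [split | rewrite pz mulVf].
case: (pselect (A x)) => [|/rel[n rx]]; first by left.
case: (pselect (A x^-1)) => [|/rel[m rx']]; first by right.
exfalso; exact: (no_relations x0 (leqnn _) rx rx').
Qed.

End Maximal.

Lemma constants_subring : subring_over (range kappa).
Proof.
split; first by move=> c; exists c.
- by move=> _ _ [c _ <-] [d _ <-]; exists (c - d) => //; rewrite rmorphB.
- by move=> _ _ [c _ <-] [d _ <-]; exists (c * d) => //; rewrite rmorphM.
Qed.

Lemma root_map_closed (p : {poly k}) y : p != 0 ->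
  root (map_poly kappa p) y -> range kappa y.
Proof.
have [s ->] := closed_field_poly_normal p => p0.
rewrite map_polyZ rootZ ?fmorph_eq0; last by apply: contraNneq p0 => ->; rewrite scale0r.
rewrite rmorph_prod /root horner_prod prodf_seq_eq0 => /hasP[c _ /=].
rewrite rmorphB /= map_polyX map_polyC hornerXsubC subr_eq0 => /eqP ->.
by exists c.
Qed.

(** An element outside the algebraically closed field of constants is
    transcendental over it, so it is not a polynomial in its inverse. *)
Lemma valuation_ring_omitting y : ~ range kappa y ->
  exists2 V, valuation_ring V & ~ V y.
Proof.
move=> ky.
have y0 : y != 0 by apply/eqP => y0; apply: ky; exists 0 => //; rewrite rmorph0.
have hR := adjoin_subring constants_subring y^-1.
have Ry : ~ adjoin (range kappa) y^-1 y.
  case=> p Rp py; pose n := size p.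
  have {Rp}/choice[c ec] : forall i, exists c, kappa c = p`_i.
    by move=> i; have [c _ ec] := Rp i; exists c.
  pose f : {poly k} := 'X^(n.+1) - \poly_(i < n.+1) c (n - i)%N.
  have fn : f`_n.+1 = 1 by rewrite coefB coefXn coef_poly ltnn eqxx subr0.
  have f0 : f != 0 by apply: contraTneq (oner_neq0 k) => f0; rewrite -fn f0 coef0 eqxx.
  apply/ky/(root_map_closed f0).
  rewrite /root rmorphB /= map_polyXn hornerD hornerN hornerXn subr_eq0.
  rewrite (_ : map_poly _ _ = \poly_(i < n.+1) p`_(n - i)); last first.
    apply/polyP => i; rewrite coef_map !coef_poly; case: ltnP => _; last exact: rmorph0.
    exact: ec.
  rewrite exprS -{1}py horner_poly.
  rewrite -(big_mkord xpredT (fun i => p`_(n - i) * y ^+ i)) big_nat_rev /= add0n.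
  rewrite (horner_coef_wide _ (leqnSn _)) mulr_suml.
  rewrite -(big_mkord xpredT (fun i => p`_i * y^-1 ^+ i * y ^+ n)).
  apply/eqP; apply: eq_big_nat => i /andP[_ le_in].
  by rewrite subSS subKn // -mulrA exprV_expr.
have [A [hA RA Ay maxA]] := maximal_subring_avoiding hR Ry.
exists A => //; apply: (maximal_avoiding_valuation_ring hA y0 Ay _ maxA).
by apply: RA; apply: mem_adjoin; apply: constants_subring.
Qed.

End ValuationRings.

(** * Comparison of sizes in a valuation ring *)

Definition vle (E : fieldType) (V : set E) (x y : E) : Prop :=
  exists2 v, V v & x = v * y.

Section Comparison.
Variables (k : closedFieldType) (E : fieldType) (kappa : {rmorphism k -> E}).
Variables (V : set E) (hV : valuation_ring kappa V).

Local Notation "x <~ y" := (vle V x y) (at level 70).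

Lemma vle_refl x : x <~ x.
Proof. by exists 1; [apply: (subring1 hV) | rewrite mul1r]. Qed.

Lemma vle0 x : 0 <~ x.
Proof. by exists 0; [apply: (subring0 hV) | rewrite mul0r]. Qed.

Lemma vle_trans y x z : x <~ y -> y <~ z -> x <~ z.
Proof.
move=> [v Vv ->] [w Vw ->]; exists (v * w); last by rewrite mulrA.
exact: (subringM hV).
Qed.

Lemma vle1 x : V x <-> x <~ 1.
Proof.
split=> [Vx|[v Vv ->]]; last by rewrite mulr1.
by exists x => //; rewrite mulr1.
Qed.

Lemma vle_total x y : x <~ y \/ y <~ x.
Proof.
have [->|x0] := eqVneq x 0; first by left; apply: vle0.
have [->|y0] := eqVneq y 0; first by right; apply: vle0.
case: (valring_total hV (x / y)) => Vxy.
  by left; exists (x / y) => //; rewrite divfK.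
by right; exists (y / x); rewrite ?divfK // -invf_div.
Qed.

Lemma vleM x x' y y' : x <~ x' -> y <~ y' -> x * y <~ x' * y'.
Proof.
move=> [v Vv ->] [w Vw ->]; exists (v * w); last by rewrite mulrACA.
exact: (subringM hV).
Qed.

Lemma vleX x y n : x <~ y -> x ^+ n <~ y ^+ n.
Proof.
move=> xy; elim: n => [|n IHn]; first exact: vle_refl.
by rewrite !exprS; apply: vleM.
Qed.

Lemma vleN x y : x <~ y -> - x <~ y.
Proof. by move=> [v Vv ->]; exists (- v); rewrite ?mulNr //; apply: (subringN hV). Qed.

Lemma vleD x y z : x <~ z -> y <~ z -> x + y <~ z.
Proof.
move=> [v Vv ->] [w Vw ->]; exists (v + w); last by rewrite mulrDl.
exact: (subringD hV).
Qed.

Lemma vleB x y z : x <~ z -> y <~ z -> x - y <~ z.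
Proof. by move=> xz yz; apply: vleD => //; apply: vleN. Qed.

Lemma vle_sum I (s : seq I) (P : pred I) (f : I -> E) z :
  (forall i, P i -> f i <~ z) -> \sum_(i <- s | P i) f i <~ z.
Proof.
move=> fz; apply: (big_ind (fun x => x <~ z)) => //; first exact: vle0.
by move=> *; apply: vleD.
Qed.

Lemma vleD_or x y : x + y <~ x \/ x + y <~ y.
Proof.
case: (vle_total x y) => h; [right|left]; apply: vleD => //; exact: vle_refl.
Qed.

Lemma vle_cst c : kappa c <~ 1.
Proof. by apply/vle1/(subring_cst hV). Qed.

Lemma vle_cstM c x : kappa c * x <~ x.
Proof. by rewrite -[X in _ <~ X]mul1r; apply: vleM; [apply: vle_cst | apply: vle_refl]. Qed.

Lemma vle_cstMK c x y : c != 0 -> kappa c * x <~ y -> x <~ y.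
Proof.
move=> c0 h; apply: vle_trans h; have c0' : kappa c != 0 by rewrite fmorph_eq0.
by rewrite -{1}[x](mulKf c0') -fmorphV; apply: vle_cstM.
Qed.

Lemma vle_mul2r z x y : z != 0 -> x * z <~ y * z -> x <~ y.
Proof. by move=> z0 [v Vv]; rewrite mulrA => /(mulIf z0) ->; exists v. Qed.

Lemma vle_invr x y : x != 0 -> x <~ y -> y^-1 <~ x^-1.
Proof.
move=> x0 [v Vv e]; exists v => //.
have v0 : v != 0 by apply: contraNneq x0 => v0; rewrite e v0 mul0r.
by rewrite e invfM mulrA mulfV // mul1r.
Qed.

(** Roots preserve the comparison because a valuation ring is integrally closed:
    if [y = v x] and [v^n] is a unit, so is [v]. *)
Lemma vle_exp_mono x y n : (0 < n)%N -> x ^+ n <~ y ^+ n -> x <~ y.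
Proof.
move=> n0 h; case: (vle_total x y) => // -[v Vv ey].
have [->|x0] := eqVneq x 0; first exact: vle0.
case: h => w Vw; rewrite ey exprMn mulrA -{1}[x ^+ n]mul1r.
move=> /(mulIf (expf_neq0 _ x0)) e1.
have v0 : v != 0.
  by apply: contra_eq_neq e1 => ->; rewrite expr0n gtn_eqF // mulr0 oner_neq0.
exists (w * v ^+ n.-1); last first.
  by rewrite mulrA -[w * _ * v]mulrA -exprSr prednK // -e1 mul1r.
by apply: (subringM hV) => //; apply: (subringX hV).
Qed.

Lemma vle1_exp x n : 1 <~ x -> 1 <~ x ^+ n.
Proof. by move=> h; rewrite -(expr1n E n); apply: vleX. Qed.

Lemma vleXl1 x m n : 1 <~ x -> (m <= n)%N -> x ^+ m <~ x ^+ n.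
Proof.
move=> h le_mn; rewrite -(subnKC le_mn) exprD -[X in X <~ _]mulr1.
by apply: vleM; [apply: vle_refl | apply: vle1_exp].
Qed.

Lemma vle_expl x n : 1 <~ x -> (0 < n)%N -> x <~ x ^+ n.
Proof. by move=> h n0; rewrite -{1}[x]expr1; apply: vleXl1. Qed.

Lemma vle_exp_le1 x m n : (m < n)%N -> x ^+ n <~ x ^+ m -> x <~ 1.
Proof.
move=> lt_mn h; have [->|x0] := eqVneq x 0; first exact: vle0.
apply: (@vle_exp_mono _ _ (n - m)); first by rewrite subn_gt0.
rewrite expr1n; apply: (@vle_mul2r (x ^+ m)); first exact: expf_neq0.
by rewrite mul1r -exprD subnK // ltnW.
Qed.

Lemma not_mem_vle x y : ~ V x -> y <~ 1 -> y <~ x.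
Proof.
move=> Vx y1; apply: vle_trans y1 _.
by case: (vle_total 1 x) => // /vle1.
Qed.

Lemma not_mem_neq0 x : ~ V x -> x != 0.
Proof. by move=> Vx; apply/eqP => x0; apply: Vx; rewrite x0; apply: (subring0 hV). Qed.

Lemma not_mem_invr x : ~ V x -> V x^-1.
Proof. by case: (valring_total hV x). Qed.

Lemma vle_horner_cst (p : {poly k}) s : ~ V s ->
  (map_poly kappa p).[s] <~ s ^+ (size p).-1.
Proof.
move=> Vs; rewrite horner_coef size_map_poly; apply: vle_sum => i _.
rewrite coef_map; apply: vle_trans (vle_cstM _ _) _.
apply: vleXl1; first by apply: not_mem_vle => //; apply: vle_refl.
by rewrite -ltnS (leq_trans (ltn_ord i)) // leqSpred.
Qed.

Lemma vge_horner_cst (p : {poly k}) s : ~ V s -> p != 0 ->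
  s ^+ (size p).-1 <~ (map_poly kappa p).[s].
Proof.
move=> Vs p0.
have s1 : 1 <~ s by apply: not_mem_vle => //; apply: vle_refl.
have sz : size p = (size p).-1.+1 by rewrite prednK // size_poly_gt0.
have lc0 : p`_(size p).-1 != 0 by rewrite -lead_coefE lead_coef_eq0.
move: (size p).-1 sz lc0 => n sz lc0; apply: (vle_cstMK lc0).
pose low := \sum_(i < n) kappa p`_i * s ^+ i.
have eps : (map_poly kappa p).[s] = low + kappa p`_n * s ^+ n.
  rewrite horner_coef size_map_poly sz big_ord_recr /= coef_map; congr (_ + _).
  by apply: eq_bigr => i _; rewrite coef_map.
have -> : kappa p`_n * s ^+ n = (map_poly kappa p).[s] - low by rewrite eps; ring.
have [e|e] := vleD_or (map_poly kappa p).[s] (- low); first exact: e.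
have {}e : s ^+ n <~ low.
  apply: (vle_cstMK lc0); apply: vle_trans (vleN (vle_refl low)).
  by apply: vle_trans e; rewrite eps addrC addKr; apply: vle_refl.
case: n => [|n] in sz lc0 low eps e *.
  move: e; rewrite /low big_ord0 expr0 => -[v _]; rewrite mulr0 => /eqP.
  by rewrite oner_eq0.
case: Vs; apply/vle1/(vle_exp_le1 (ltnSn n))/(vle_trans e).
apply: vle_sum => i _; apply: vle_trans (vle_cstM _ _) _.
by apply: vleXl1 => //; rewrite -ltnS.
Qed.

End Comparison.

(** * Parameters with a capacity gap form a finite set *)

Lemma size_expS (R : idomainType) (p : {poly R}) n : p != 0 ->
  size (p ^+ n) = ((size p).-1 * n).+1.
Proof. by move=> p0; rewrite -size_exp prednK // size_poly_gt0 expf_neq0. Qed.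

Section Capacity.
Variables (k : closedFieldType) (E : fieldType) (kappa : {rmorphism k -> E}).

Local Notation valuation_ring := (valuation_ring kappa).

(** The product formula in the only form that is used: a nonzero [y] cannot be
    integral away from the pole of [s] and vanish at that pole. A nonconstant
    [y] is omitted by some valuation ring, and a constant [y] would bound [s]
    everywhere. *)
Lemma no_small_nonzero s y : ~ range kappa s -> y != 0 ->
  (forall V, valuation_ring V -> V s -> V y) ->
  (forall V, valuation_ring V -> ~ V s -> V (s * y)) -> False.
Proof.
move=> ks y0 fin inf; case: (pselect (range kappa y)) => [[c _ ec]|ky].
  have [V hV Vs] := valuation_ring_omitting ks; apply: (Vs).
  rewrite -(mulfK y0 s); apply: (subringM hV); first exact: inf.
  by rewrite -ec -fmorphV; apply: (subring_cst hV).
have [V hV Vy] := valuation_ring_omitting ky; apply: Vy.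
case: (pselect (V s)) => Vs; first exact: fin.
rewrite -(mulKf (not_mem_neq0 hV Vs) y); apply: (subringM hV); last exact: inf.
exact: (not_mem_invr hV Vs).
Qed.

(** The [e i] arise from the powers of [z] by a triangular change of basis. *)
Lemma det_horner_triangular n (e : nat -> {poly E}) (x : 'rV[E]_n) :
  (forall i, size (e i) = i.+1) ->
  \det (\matrix_(i < n, j < n) (e i).[x 0 j])
    = \prod_(i < n) lead_coef (e i) * \det (Vandermonde n x).
Proof.
move=> se; pose T := \matrix_(i < n, j < n) (e i)`_j.
have -> : \matrix_(i < n, j < n) (e i).[x 0 j] = T *m Vandermonde n x.
  apply/matrixP => i j; rewrite !mxE (@horner_coef_wide _ n) ?se //.
  by apply: eq_bigr => l _; rewrite !mxE.
rewrite det_mulmx det_trig; last first.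
  by apply/is_trig_mxP => i j lt_ij; rewrite mxE nth_default // se.
by congr (_ * _); apply: eq_bigr => i _; rewrite mxE lead_coefE se.
Qed.

(** In the bases below the exponents of the polynomial of degree [d] grow with
    [n] while those of [z] stay below [d], so the former outweigh any fixed
    multiple of the latter. *)
Lemma sum_divn_modn_gap d C : (0 < d)%N -> exists n,
  (C * (\sum_(i < n) i %% d) < \sum_(i < n) i %/ d)%N.
Proof.
move=> d0; pose m := (2 * d * C).+1; exists (d * m + d * m)%N.
have le_mod : (\sum_(i < d * m + d * m) i %% d <= (d * m + d * m) * d)%N.
  rewrite -[X in (_ <= X * _)%N]card_ord -sum_nat_const; apply: leq_sum => i _.
  by rewrite ltnW // ltn_mod.
have le_div : (d * m * m <= \sum_(i < d * m + d * m) i %/ d)%N.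
  rewrite big_split_ord /= -[X in (X * _ <= _)%N]card_ord -sum_nat_const.
  apply: leq_trans (leq_addl _ _); apply: leq_sum => i _.
  by rewrite leq_divRL // mulnC leq_addr.
apply: leq_ltn_trans (leq_mul (leqnn C) le_mod) (leq_trans _ le_div).
rewrite /m; nia.
Qed.

(** Let [A] and [B] have the same degree, [A] being bounded on [S] at the places
    where [s] is finite and [B] at the others. Products of powers of [z] and [A],
    resp. [z] and [B], provide two bases of the polynomials of degree less than
    [n]. The determinants of their values at [n] points of [S] differ from the
    Vandermonde determinant by the product of the leading coefficients, and the
    gap between those of [A] and [B] makes this determinant too small to be
    nonzero. *)
Lemma capacity_gap_finite s (S : set E) (A B : {poly E}) (gA gB : E) d C :
  ~ range kappa s -> (0 < d)%N -> size A = d.+1 -> size B = d.+1 ->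
  gA != 0 -> gB != 0 ->
  (forall V x, valuation_ring V -> V s -> S x -> V A.[x] /\ V (gA * x)) ->
  (forall V x, valuation_ring V -> ~ V s -> S x -> V B.[x] /\ V (gB * x)) ->
  (forall V, valuation_ring V -> ~ V s ->
     vle V (s * lead_coef A) (lead_coef B) /\ vle V gA (s ^+ C * gB)) ->
  finite_set S.
Proof.
move=> ks d0 sA sB gA0 gB0 bA bB gap; apply: contrapT => infS.
have [n lt_n] := sum_divn_modn_gap C d0.
have [X XS le_n] := infinite_set_fset n infS.
pose x : 'rV[E]_n := \row_i nth 0 (finmap.enum_fset X) i.
have Sx i : S (x 0 i).
  by apply: XS; rewrite mxE /=; apply: mem_nth; apply: leq_trans le_n.
pose e (D : {poly E}) (g : E) i := (g *: 'X) ^+ (i %% d) * D ^+ (i %/ d).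
have size_e (D : {poly E}) (g : E) : g != 0 -> size D = d.+1 ->
    forall i, size (e D g i) = i.+1.
  move=> g0 sD i.
  have D0 : D != 0 by rewrite -size_poly_eq0 sD.
  have gX0 : g *: 'X != 0 by rewrite scaler_eq0 negb_or g0 polyX_eq0.
  rewrite size_mul ?expf_neq0 // !size_expS // size_scale // size_polyX sD /=.
  by rewrite mul1n addnS [in RHS](divn_eq i d); congr _.+1; rewrite addnC mulnC.
have lead_e (D : {poly E}) (g : E) i :
    lead_coef (e D g i) = g ^+ (i %% d) * lead_coef D ^+ (i %/ d).
  by rewrite lead_coefM !lead_coef_exp lead_coefZ lead_coefX mulr1.
have A0 : A != 0 by rewrite -size_poly_eq0 sA.
have B0 : B != 0 by rewrite -size_poly_eq0 sB.
pose M D g := \det (\matrix_(i < n, j < n) (e D g i).[x 0 j]).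
have MV (D : {poly E}) (g : E) V : valuation_ring V ->
    (forall j, V D.[x 0 j] /\ V (g * x 0 j)) -> V (M D g).
  move=> hV VD; apply: (subring_det hV) => i j.
  rewrite mxE hornerM !horner_exp hornerZ hornerX.
  by have [VDj Vgj] := VD j; apply: (subringM hV); apply: (subringX hV).
have vdm0 : \det (Vandermonde n x) != 0.
  rewrite det_Vandermonde; apply/prodf_neq0 => i _; apply/prodf_neq0 => j lt_ij.
  rewrite subr_eq0 !mxE nth_uniq ?finmap.fset_uniq //; first by rewrite gtn_eqF.
    by apply: leq_trans le_n.
  by apply: leq_trans le_n.
have prod_lead (D : {poly E}) (g : E) : \prod_(i < n) lead_coef (e D g i)
    = g ^+ (\sum_(i < n) i %% d)%N * lead_coef D ^+ (\sum_(i < n) i %/ d)%N.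
  by under eq_bigr do rewrite lead_e; rewrite big_split /= !prodrXr.
apply: (@no_small_nonzero s (M A gA)) => //.
- rewrite /M det_horner_triangular ?prod_lead; last exact: size_e.
  by rewrite !mulf_neq0 ?expf_neq0 ?lead_coef_eq0.
- by move=> V hV Vs; apply: MV => // j; apply: bA.
move=> V hV Vs; have [gapl gapg] := gap V hV Vs.
have s1 : vle V 1 s by apply: (not_mem_vle hV) => //; apply: (vle_refl hV).
have hB : V (M B gB) by apply: MV => // j; apply: bB.
apply/vle1; apply: (@vle_trans _ _ _ _ hV (M B gB)); last exact/(vle1 V).
rewrite /M !det_horner_triangular ?prod_lead; try exact: size_e.
set X1 := (\sum_(i < n) i %% d)%N in lt_n *; set Y := (\sum_(i < n) i %/ d)%N in lt_n *.
rewrite mulrA; apply: (vleM hV); last exact: (vle_refl hV).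
have s0 := not_mem_neq0 hV Vs.
apply: (@vle_mul2r _ _ (s ^+ (C * X1))); first exact: expf_neq0.
apply: (@vle_trans _ _ _ _ hV (gA ^+ X1 * (s * lead_coef A) ^+ Y)).
  have -> : s * (gA ^+ X1 * lead_coef A ^+ Y) * s ^+ (C * X1)
      = gA ^+ X1 * lead_coef A ^+ Y * s ^+ (C * X1).+1 by rewrite exprS; ring.
  rewrite exprMn [s ^+ Y * _]mulrC mulrA; apply: (vleM hV); first exact: (vle_refl hV).
  exact: (vleXl1 hV).
rewrite [X in vle _ _ X]mulrAC; apply: (vleM hV).
  by rewrite [X in vle _ _ X]mulrC exprM -exprMn; apply: (vleX hV).
exact: (vleX hV).
Qed.

End Capacity.

(** * Torsion parameters and their sizes *)

Section Dynamics.
Variables (F : finFieldType) (k : closedFieldType) (iota : {rmorphism F -> k}).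
Variables (E : closedFieldType) (kappa : {rmorphism k -> E}) (t : E) (q Q : nat).

Definition phi (l x : E) : E := t * x + l * x ^+ q + x ^+ Q.

Definition torsion (l x : E) : Prop :=
  exists2 a : {poly F}, a != 0 &
    \sum_(i < size a) kappa (iota a`_i) * iter i (phi l) x = 0.

Hypotheses (q_gt1 : (1 < q)%N) (le_q2Q : (2 * q <= Q)%N).

Section Valuation.
Variables (V : set E) (hV : valuation_ring kappa V).

Local Notation "x <~ y" := (vle V x y) (at level 70).

(** Beyond [rho] the term [x^Q] dominates [phi l x], so the orbit grows
    strictly and satisfies no linear relation over the constants. *)
Lemma torsion_vle l rho x : 1 <~ rho -> l <~ rho ^+ (Q - q) -> t <~ rho ^+ (Q - 1) ->
  torsion l x -> x <~ rho.
Proof.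
move=> rho1 l_rho t_rho [a a0 rel]; apply: contrapT => x_rho.
have grow y : ~ y <~ rho -> ~ phi l y <~ y.
  move=> y_rho; apply: contra_not y_rho => phi_y.
  have rho_y_of1 : y <~ 1 -> y <~ rho by move=> y1; apply: (vle_trans hV) y1 rho1.
  have eQ : y ^+ Q = phi l y - t * y - l * y ^+ q by rewrite /phi; ring.
  have small m z : (m < Q)%N -> z <~ rho ^+ (Q - m) -> y ^+ Q <~ z * y ^+ m -> y <~ rho.
    move=> lt_mQ z_rho; have [->|y0] := eqVneq y 0; first by move=> _; apply: (vle0 hV).
    rewrite -{1}(subnK (ltnW lt_mQ)) exprD => /(vle_mul2r (expf_neq0 _ y0)) h.
    by apply: (vle_exp_mono hV) (vle_trans hV h z_rho); rewrite subn_gt0.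
  have [h|h] := vleD_or hV (phi l y - t * y) (- (l * y ^+ q)); rewrite -eQ in h; last first.
    apply: (small q l) => //; first lia.
    rewrite -[l * _]opprK; apply: (vle_trans hV h); rewrite -[X in vle V X _]opprK.
    by apply: (vleN hV); rewrite opprK; apply: (vle_refl hV).
  have [h'|h'] := vleD_or hV (phi l y) (- (t * y)); have {h h'}h := vle_trans hV h h'.
    apply: (small 1%N 1) => //; first lia.
      by apply: (vle1_exp hV).
    by rewrite mul1r expr1; apply: (vle_trans hV h).
  apply: (small 1%N t) => //; first lia.
  by rewrite expr1; apply: (vle_trans hV h); apply: (vleN hV); apply: (vle_refl hV).
have large i : ~ iter i (phi l) x <~ rho.
  elim: i => [|i IHi] //= h; apply: (grow _ IHi); apply: (vle_trans hV h).
  by case: (vle_total hV rho (iter i (phi l) x)) => // /IHi.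
have mono i j : (i <= j)%N -> iter i (phi l) x <~ iter j (phi l) x.
  elim: j => [|j IHj]; first by rewrite leqn0 => /eqP ->; apply: (vle_refl hV).
  rewrite leq_eqVlt => /predU1P[->|]; first exact: (vle_refl hV).
  rewrite ltnS => /IHj h; apply: (vle_trans hV h) => /=.
  by case: (vle_total hV (iter j (phi l) x) (phi l (iter j (phi l) x))) => // /grow - /(_ (large j)).
have lc0 : a`_(size a).-1 != 0 by rewrite -lead_coefE lead_coef_eq0.
have sz : size a = (size a).-1.+1 by rewrite prednK // size_poly_gt0.
move: (size a).-1 sz lc0 => n sz lc0.
move: rel; rewrite sz big_ord_recr /= addrC => /eqP; rewrite addr_eq0 => /eqP rel.
have top : iter n (phi l) x <~ \sum_(i < n) kappa (iota a`_i) * iter i (phi l) x.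
  apply: (@vle_cstMK _ _ _ _ hV (iota a`_n)); first by rewrite fmorph_eq0.
  by rewrite rel; apply: (vleN hV); apply: (vle_refl hV).
case: n => [|n] in sz lc0 rel top *.
  apply: (large 0%N); apply: (vle_trans hV top); rewrite big_ord0; exact: (vle0 hV).
apply: (grow _ (large n)); apply: (vle_trans hV top); apply: (vle_sum hV) => i _.
by apply: (vle_trans hV (vle_cstM hV _ _)); apply: mono; rewrite -ltnS.
Qed.

End Valuation.

Lemma closed_root_exp n (x : E) : (0 < n)%N -> exists y, y ^+ n = x.
Proof.
move=> n0; have [y] := @closed_rootP E ('X^n - x%:P) ltac:(by rewrite size_XnsubC // eqSS -lt0n).
by rewrite /root !hornerE subr_eq0 => /eqP; exists y.
Qed.

(** * Orbits as polynomials in the parameter *)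

Definition phi_poly (P : {poly E}) : {poly E} := t *: P + 'X * P ^+ q + P ^+ Q.

Definition orbit_poly (a : E) n : {poly E} := iter n phi_poly a%:P.

Lemma horner_phi_poly P l : (phi_poly P).[l] = phi l P.[l].
Proof. by rewrite /phi_poly /phi !hornerE. Qed.

Lemma horner_orbit_poly a n l : (orbit_poly a n).[l] = iter n (phi l) a.
Proof. by elim: n => [|n IHn] /=; rewrite ?hornerC // horner_phi_poly IHn. Qed.

Lemma size_lead_phi_polyC a : a != 0 ->
  size (phi_poly a%:P) = 2 /\ lead_coef (phi_poly a%:P) = a ^+ q.
Proof.
move=> a0; rewrite /phi_poly -!rmorphXn /= addrAC -mul_polyC -polyCM -polyCD addrC mulrC.
have aq0 : a ^+ q != 0 by rewrite expf_neq0.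
have lt_size : (size ((t * a + a ^+ Q)%:P : {poly E}) < size ((a ^+ q)%:P * 'X)%R)%N.
  by rewrite size_mulX ?polyC_eq0 // (size_polyC (a ^+ q)) aq0 ltnS size_polyC_leq1.
rewrite size_polyDl // lead_coefDl // size_mulX ?polyC_eq0 // size_polyC aq0.
by rewrite lead_coefMX lead_coefC.
Qed.

(** The term [P^Q] wins because [Q d > q d + 1]. *)
Lemma size_lead_phi_poly (P : {poly E}) d : (0 < d)%N -> size P = d.+1 ->
  size (phi_poly P) = (d * Q).+1 /\ lead_coef (phi_poly P) = lead_coef P ^+ Q.
Proof.
move=> d0 sP; have P0 : P != 0 by rewrite -size_poly_eq0 sP.
have sPn n : size (P ^+ n) = (d * n).+1 by rewrite size_expS // sP.
have lt_size : (size (t *: P + 'X * P ^+ q)%R < size (P ^+ Q))%N.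
  rewrite sPn ltnS (leq_trans (size_polyD _ _)) // geq_max.
  rewrite (leq_trans (size_scale_leq _ _)) ?sP /=; last nia.
  by rewrite mulrC size_mulX ?expf_neq0 // sPn; nia.
by rewrite /phi_poly addrC size_polyDl // lead_coefDl // sPn lead_coef_exp.
Qed.

Lemma size_lead_orbit_poly a n : a != 0 ->
  size (orbit_poly a n.+1) = (Q ^ n).+1 /\
  lead_coef (orbit_poly a n.+1) = (a ^+ q) ^+ (Q ^ n).
Proof.
move=> a0; elim: n => [|n [sn ln]]; first exact: size_lead_phi_polyC.
have Qn0 : (0 < Q ^ n)%N by rewrite expn_gt0; apply/orP; left; lia.
have [-> ->] := size_lead_phi_poly Qn0 sn.
by rewrite ln expnSr; split=> //; rewrite [in RHS]exprM.
Qed.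

(** * Bounds for torsion parameters *)

Hypothesis E_q : [pchar E].-nat q.
Hypothesis F_q : forall c : F, c ^+ q = c.
Variable r : nat.
Hypothesis Q_q : Q = (q ^ r)%N.

Lemma E_Q : [pchar E].-nat Q.
Proof. by rewrite Q_q pnatX E_q. Qed.

Lemma phi0 l : phi l 0 = 0.
Proof. by rewrite /phi !expr0n !gtn_eqF; [rewrite !mulr0 !addr0 | lia | lia]. Qed.

Lemma phiD l x y : phi l (x + y) = phi l x + phi l y.
Proof. by rewrite /phi !exprDn_pchar ?E_Q //; ring. Qed.

Lemma phi_cst l (c : F) x : phi l (kappa (iota c) * x) = kappa (iota c) * phi l x.
Proof.
have cQ n : c ^+ (q ^ n) = c.
  by elim: n => [|n IHn]; rewrite ?expn0 ?expr1 // expnS exprM F_q.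
by rewrite /phi !exprMn -!rmorphXn /= F_q Q_q cQ; ring.
Qed.

Lemma torsion_phi l x : torsion l x -> torsion l (phi l x).
Proof.
move=> [a a0 rel]; exists a => //; apply: etrans (phi0 l); rewrite -{2}rel.
rewrite (big_morph (phi l) (phiD l) (phi0 l)); apply: eq_bigr => i _.
by rewrite phi_cst -iterSr.
Qed.

Lemma torsion_iter l x n : torsion l x -> torsion l (iter n (phi l) x).
Proof. by move=> tx; elim: n => //= n; apply: torsion_phi. Qed.

(** With [rho^(Q - q) = l], either [l] is already small, or [rho] bounds the
    torsion; then [l a^q = phi l a - t a - a^Q] cannot be large. *)
Lemma torsion_bound_at V l h a x : valuation_ring kappa V ->
  vle V 1 h -> vle V t h -> vle V a h -> vle V a^-1 h -> a != 0 ->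
  torsion l a -> torsion l x -> vle V l (h ^+ (q * Q)) /\ vle V x (h ^+ (q * Q)).
Proof.
move=> hV h1 th ah aVh a0 ta tx.
have mono := vleXl1 hV h1.
suff lh : vle V l (h ^+ (q * Q)).
  split=> //; apply: torsion_vle tx => //; first exact: (vle1_exp hV).
    by apply: (vle_trans hV lh); apply: (vle_expl hV); [apply: (vle1_exp hV) | lia].
  by apply: (vle_trans hV th); rewrite -exprM; apply: (vle_expl hV) => //; nia.
have [rho e_rho] : exists rho, rho ^+ (Q - q) = l by apply: closed_root_exp; lia.
case: (vle_total hV rho h) => h_rho.
  rewrite -e_rho; apply: (vle_trans hV (vleX hV _ h_rho)); apply: mono; nia.
have rho1 := vle_trans hV h1 h_rho.
have phi_rho : vle V (phi l a) rho.
  apply: torsion_vle (torsion_phi ta) => //; first by rewrite e_rho; apply: (vle_refl hV).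
  by apply: (vle_trans hV th); apply: (vle_trans hV h_rho); apply: (vle_expl hV) => //; lia.
have e_l : l = (phi l a - (t * a + a ^+ Q)) * a^-1 ^+ q.
  rewrite exprVn /phi; field; exact: expf_neq0.
have small : vle V (t * a + a ^+ Q) (h ^+ Q).
  apply: (vleD hV); last exact: (vleX hV).
  by apply: (vle_trans hV (vleM hV th ah)); rewrite -expr2; apply: mono; lia.
have aVq : vle V (a^-1 ^+ q) (h ^+ q) by apply: (vleX hV).
have [e|e] := vleD_or hV (phi l a) (- (t * a + a ^+ Q)); last first.
  rewrite e_l; apply: (@vle_trans _ _ _ _ hV (h ^+ Q * h ^+ q)).
    by apply: (vleM hV) => //; apply: (vle_trans hV e); apply: (vleN hV).
  by rewrite -exprD; apply: mono; nia.
have l_rho : vle V l (rho * h ^+ q).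
  by rewrite e_l; apply: (vleM hV) => //; apply: (vle_trans hV e).
have rho_h : vle V rho (h ^+ q).
  have rho0 : rho != 0.
    by apply: contraPneq rho1 => -> [v _]; rewrite mulr0; apply/eqP/oner_neq0.
  apply: (vle_trans hV (vle_expl hV rho1 (_ : 0 < Q - q - 1)%N)); first lia.
  apply: (vle_mul2r rho0); rewrite -exprSr [_ * rho]mulrC.
  by rewrite (_ : (Q - q - 1).+1 = Q - q)%N ?e_rho //; lia.
rewrite -e_rho; apply: (vle_trans hV (vleX hV _ rho_h)); rewrite -exprM; apply: mono; nia.
Qed.

(** * Rational functions of a transcendental element *)

Definition ratl (s x : E) : Prop :=
  exists u v : {poly k}, (map_poly kappa v).[s] != 0 /\
    x = (map_poly kappa u).[s] / (map_poly kappa v).[s].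

Lemma ratl_horner s (u : {poly k}) : ratl s (map_poly kappa u).[s].
Proof. by exists u, 1; rewrite rmorph1 hornerC oner_neq0 divr1. Qed.

Lemma ratl_cst s c : ratl s (kappa c).
Proof. by have := ratl_horner s c%:P; rewrite map_polyC hornerC. Qed.

Lemma ratl_id s : ratl s s.
Proof. by have := ratl_horner s 'X; rewrite map_polyX hornerX. Qed.

Lemma ratlD s x y : ratl s x -> ratl s y -> ratl s (x + y).
Proof.
move=> [u [v [v0 ->]]] [u' [v' [v'0 ->]]]; exists (u * v' + u' * v), (v * v').
by rewrite !rmorphD !rmorphM !hornerE; split; [rewrite mulf_neq0 | rewrite addf_div].
Qed.

Lemma ratlM s x y : ratl s x -> ratl s y -> ratl s (x * y).
Proof.
move=> [u [v [v0 ->]]] [u' [v' [v'0 ->]]]; exists (u * u'), (v * v').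
by rewrite !rmorphM !hornerM mulf_div; split=> //; rewrite mulf_neq0.
Qed.

Lemma ratlV s x : ratl s x -> ratl s x^-1.
Proof.
move=> [u [v [v0 ->]]].
have [u0|u0] := eqVneq (map_poly kappa u).[s] 0.
  by rewrite u0 mul0r invr0 -(rmorph0 kappa); apply: ratl_cst.
by exists v, u; rewrite u0 invf_div.
Qed.

Lemma ratlX s x n : ratl s x -> ratl s (x ^+ n).
Proof.
move=> hx; elim: n => [|n IHn]; last by rewrite exprS; apply: ratlM.
by rewrite expr0 -(rmorph1 kappa); apply: ratl_cst.
Qed.

Lemma ratl_trans s x y : ratl s x -> ratl x y -> ratl s y.
Proof.
move=> hx [u [v [v0 ->]]].
have sub (w : {poly k}) : ratl s (map_poly kappa w).[x].
  rewrite horner_coef; apply: big_ind => [|x1 x2|i _]; last first.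
  - by rewrite coef_map; apply: ratlM; [apply: ratl_cst | apply: ratlX].
  - exact: ratlD.
  - by rewrite -(rmorph0 kappa); apply: ratl_cst.
by apply: ratlM; [|apply: ratlV]; apply: sub.
Qed.

(** At the finite places of [k(s)] a common denominator [g] serves, and at the place
    [s = oo] a polynomial is as large as its leading term. *)
Lemma ratl_bounds s (xs : seq E) : (forall x, x \in xs -> ratl s x) ->
  exists g C, [/\ g != 0,
    forall V, valuation_ring kappa V -> V s -> V g /\ forall x, x \in xs -> V (g * x) &
    forall V, valuation_ring kappa V -> ~ V s ->
      vle V g (s ^+ C) /\ forall x, x \in xs -> vle V x (s ^+ C)].
Proof.
elim: xs => [_|x xs IHxs hxs].
  exists 1, 0%N; split; first exact: oner_neq0.
    by move=> V hV _; split=> //; apply: (subring1 hV).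
  by move=> V hV _; split=> //; apply: (vle_refl hV).
have [|g [C [g0 fin inf]]] := IHxs.
  by move=> y y_xs; apply: hxs; rewrite inE y_xs orbT.
have [|u [v [v0 ex]]] := hxs x; first by rewrite inE eqxx.
pose m := ((size u).-1 + (size v).-1)%N.
exists (g * (map_poly kappa v).[s]), (C + m)%N; split; first exact: mulf_neq0.
  move=> V hV Vs; have [Vg Vgx] := fin V hV Vs.
  have Vv : V (map_poly kappa v).[s] by apply: (subring_map_horner hV).
  split; first exact: (subringM hV).
  move=> y; rewrite inE => /predU1P[->|/Vgx Vgy].
    rewrite ex -mulrA; apply: (subringM hV) => //.
    by rewrite mulrC divfK //; apply: (subring_map_horner hV).
  by rewrite mulrAC; apply: (subringM hV).
move=> V hV Vs; have [Vg Vgx] := inf V hV Vs.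
have s1 : vle V 1 s by apply: (not_mem_vle hV) => //; apply: (vle_refl hV).
have mono := vleXl1 hV s1.
split.
  rewrite exprD; apply: (vleM hV) => //; apply: (vle_trans hV (vle_horner_cst hV v Vs)).
  exact/mono/leq_addl.
move=> y; rewrite inE => /predU1P[->|/Vgx Vgy]; last first.
  by apply: (vle_trans hV Vgy); apply/mono/leq_addr.
have vp0 : v != 0 by apply: contraNneq v0 => ->; rewrite rmorph0 horner0.
rewrite ex -[s ^+ _]mulr1 -invr1; apply: (vleM hV).
  by apply: (vle_trans hV (vle_horner_cst hV u Vs)); apply: mono; rewrite /m; lia.
apply: (vle_invr (oner_neq0 _)); apply: (vle_trans hV _ (vge_horner_cst hV Vs vp0)).
exact: (vle1_exp hV).
Qed.

(** * The capacity argument for torsion parameters *)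

(** The bounds are uniform in [l] and [x]: [g] clears denominators where [s] is
    finite, and [s^C] bounds sizes where it is not. *)
Lemma torsion_bounds s a : ratl s t -> ratl s a -> a != 0 -> exists g C,
  [/\ g != 0,
    forall V l x, valuation_ring kappa V -> V s -> torsion l a -> torsion l x ->
      V (g * x) /\ V (g * l) &
    forall V, valuation_ring kappa V -> ~ V s -> vle V g (s ^+ C) /\
      forall l x, torsion l a -> torsion l x ->
      vle V x (s ^+ C) /\ vle V l (s ^+ C)].
Proof.
move=> st sa a0.
have [|g [C [g0 fin inf]]] := @ratl_bounds s [:: t; a; a^-1].
  by move=> x; rewrite !inE => /or3P[] /eqP -> //; apply: ratlV.
exists (g ^+ (q * Q)), (C * (q * Q))%N; split; first exact: expf_neq0.
  move=> V l x hV Vs ta tx; have [Vg Vgx] := fin V hV Vs.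
  have g1 : vle V 1 g^-1 by rewrite -invr1; apply: (vle_invr g0); apply/(vle1 V).
  have hg y : V (g * y) -> vle V y g^-1.
    by move=> Vgy; exists (g * y) => //; rewrite mulrAC mulfV // mul1r.
  have [] := @torsion_bound_at V l g^-1 a x hV g1 _ _ _ a0 ta tx.
  - by apply: hg; apply: Vgx; rewrite inE eqxx.
  - by apply: hg; apply: Vgx; rewrite !inE eqxx orbT.
  - by apply: hg; apply: Vgx; rewrite !inE eqxx !orbT.
  have gh y : vle V y (g^-1 ^+ (q * Q)) -> V (g ^+ (q * Q) * y).
    by move=> [v Vv ->]; rewrite mulrCA -exprMn mulfV // expr1n mulr1.
  by move=> /gh Vl /gh Vx.
move=> V hV Vs; have [Vg Vgx] := inf V hV Vs; split.
  by rewrite (exprM s); apply: (vleX hV).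
move=> l x ta tx.
have s1 : vle V 1 s by apply: (not_mem_vle hV) => //; apply: (vle_refl hV).
have [||||] := @torsion_bound_at V l (s ^+ C) a x hV _ _ _ _ a0 ta tx.
- exact: (vle1_exp hV).
- by apply: Vgx; rewrite inE eqxx.
- by apply: Vgx; rewrite !inE eqxx orbT.
- by apply: Vgx; rewrite !inE eqxx !orbT.
by rewrite -exprM.
Qed.

(** The bounds cost a fixed power of [s], so it suffices that the gap between the
    leading coefficients exceeds every such power as the degree grows. *)
Lemma capacity_gap_torsion s a (S : set E) : ~ range kappa s ->
  ratl s t -> ratl s a -> a != 0 -> (forall l, S l -> torsion l a) ->
  (forall C, exists d (A B : {poly E}),
    [/\ (0 < d)%N, size A = d.+1 /\ size B = d.+1,
      forall V l, valuation_ring kappa V -> S l ->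
        exists2 x, torsion l x & vle V A.[l] x,
      forall V l, valuation_ring kappa V -> S l ->
        exists2 x, torsion l x & vle V B.[l] x &
      forall V, valuation_ring kappa V -> ~ V s ->
        vle V (s ^+ C * lead_coef A) (lead_coef B)]) ->
  finite_set S.
Proof.
move=> ks st sa a0 Sa gaps.
have [g [C [g0 fin inf]]] := torsion_bounds st sa a0.
have [d [A [B [d0 [sA sB] bA bB gap]]]] := gaps (C + C).+1.
have s0 : s != 0.
  by apply/eqP => s0; apply: ks; exists 0 => //; rewrite s0 rmorph0.
have sC0 : s^-1 ^+ C != 0 by rewrite expf_neq0 // invr_eq0.
apply: (@capacity_gap_finite _ _ kappa s S (g *: A) (s^-1 ^+ C *: B) g (s^-1 ^+ C) d (C + C)) => //.
- by rewrite size_scale.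
- by rewrite size_scale.
- move=> V l hV Vs Sl; have [x tx Ax] := bA V l hV Sl.
  have [Vgx Vgl] := fin V l x hV Vs (Sa l Sl) tx; split=> //.
  by case: Ax => v Vv e; rewrite hornerZ e mulrCA; apply: (subringM hV).
- move=> V l hV Vs Sl; have [x tx Bx] := bB V l hV Sl.
  have [_ /(_ l x (Sa l Sl) tx)[Vx Vl]] := inf V hV Vs.
  have scale y : vle V y (s ^+ C) -> V (s^-1 ^+ C * y).
    by move=> [v Vv ->]; rewrite mulrCA -exprMn mulVf // expr1n mulr1.
  by split; [rewrite hornerZ; apply: scale; apply: (vle_trans hV Bx Vx) | apply: scale].
move=> V hV Vs; split; last first.
  rewrite exprD -mulrA -exprMn mulfV // expr1n mulr1.
  by case: (inf V hV Vs).
have [gs _] := inf V hV Vs; rewrite !lead_coefZ.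
apply: (@vle_mul2r _ _ (s ^+ C)); first exact: expf_neq0.
have -> : s^-1 ^+ C * lead_coef B * s ^+ C = lead_coef B.
  by rewrite mulrAC -exprMn mulVf // expr1n mul1r.
apply: (vle_trans hV _ (gap V hV Vs)).
have -> : s * (g * lead_coef A) * s ^+ C = g * (s ^+ C.+1 * lead_coef A).
  by rewrite exprS; ring.
have -> : s ^+ (C + C).+1 * lead_coef A = s ^+ C * (s ^+ C.+1 * lead_coef A).
  by rewrite exprS exprD exprS; ring.
by apply: (vleM hV) => //; apply: (vle_refl hV).
Qed.

Lemma exp_ge_id C : (C <= q * Q ^ C)%N.
Proof.
have Q1 : (1 < Q)%N by lia.
by apply: leq_trans (ltnW (ltn_expl C Q1)) _; rewrite leq_pmull //; lia.
Qed.

(** * Comparison of the two starting points *)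

Hypothesis kt : ~ range kappa t.

(** At a zero [alpha] of [b / a] the torsion parameters of [a] and those of [b]
    have different capacities. *)
Lemma ratio_zero_finite a b (u w : {poly k}) alpha (S : set E) :
  ratl t a -> a != 0 -> b != 0 ->
  b * (map_poly kappa u).[t] = a * (map_poly kappa w).[t] ->
  root w alpha -> ~~ root u alpha ->
  (forall l, S l -> torsion l a /\ torsion l b) -> finite_set S.
Proof.
move=> ta a0 b0 e_ba w_alpha u_alpha Sab.
pose s := (t - kappa alpha)^-1.
have es : t = kappa alpha + s^-1 by rewrite invrK addrC subrK.
have ks : ~ range kappa s.
  case=> c _ ec; apply: kt; exists (alpha + c^-1) => //.
  by rewrite rmorphD fmorphV /= ec -es.
have st : ratl s t.
  by rewrite es; apply: ratlD; [apply: ratl_cst | apply/ratlV/ratl_id].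
apply: (@capacity_gap_torsion s a S ks st (ratl_trans st ta) a0).
  by move=> l /Sab[].
move=> C; exists (Q ^ C)%N, (orbit_poly b C.+1), (orbit_poly a C.+1).
have [sA lA] := size_lead_orbit_poly C b0; have [sB lB] := size_lead_orbit_poly C a0.
split=> //.
- by rewrite expn_gt0; apply/orP; left; lia.
- move=> V l hV /Sab[_ tb]; exists (iter C.+1 (phi l) b); first exact: torsion_iter.
  by rewrite horner_orbit_poly; apply: (vle_refl hV).
- move=> V l hV /Sab[tora _]; exists (iter C.+1 (phi l) a); first exact: torsion_iter.
  by rewrite horner_orbit_poly; apply: (vle_refl hV).
move=> V hV Vs; rewrite lA lB -!exprM.
have Vt : V t.
  rewrite es; apply: (subringD hV); first exact: (subring_cst hV).
  exact: (not_mem_invr hV Vs).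
have s0 := not_mem_neq0 hV Vs.
have tE (p : {poly k}) : exists2 v, V v &
    (map_poly kappa p).[t] = kappa p.[alpha] + s^-1 * v.
  have : root (p - p.[alpha]%:P) alpha by rewrite /root !hornerE subrr.
  move/factor_theorem => [p' ep]; exists (map_poly kappa p').[t].
    exact: (subring_map_horner hV).
  rewrite -[p in LHS](subrK p.[alpha]%:P) ep rmorphD rmorphM rmorphB /= map_polyX !map_polyC.
  by rewrite !hornerE /= es; ring.
(* the denominator does not vanish at alpha, so it is a unit of V *)
have u1 : vle V 1 (map_poly kappa u).[t].
  have [v Vv eu] := tE u.
  apply: (@vle_cstMK _ _ _ _ hV u.[alpha]) => //; rewrite mulr1.
  have -> : kappa u.[alpha] = (map_poly kappa u).[t] - s^-1 * v by rewrite eu; ring.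
  have [h|h] := vleD_or hV (map_poly kappa u).[t] (- (s^-1 * v)); first exact: h.
  exfalso; apply: Vs; apply/(vle1 V).
  have h1 : vle V 1 (s^-1 * v).
    apply: (@vle_cstMK _ _ _ _ hV u.[alpha]) => //; rewrite mulr1 -[X in vle V _ X]opprK.
    rewrite (_ : kappa _ = (map_poly kappa u).[t] - s^-1 * v); last by rewrite eu; ring.
    by apply: (vle_trans hV h); apply: (vleN hV); rewrite opprK; apply: (vle_refl hV).
  apply: (@vle_mul2r _ _ s^-1); first by rewrite invr_eq0.
  rewrite mulfV // mul1r; apply: (vle_trans hV h1); rewrite mulrC -[X in vle V _ X]mul1r.
  by apply: (vleM hV (iffLR (vle1 V v) Vv)); apply: (vle_refl hV).
have sb_a : vle V (s * b) a.
  apply: (@vle_trans _ _ _ _ hV (s * b * (map_poly kappa u).[t])).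
    by rewrite -[X in vle V X _]mulr1; apply: (vleM hV) u1; apply: (vle_refl hV).
  have [v Vv ew] := tE w.
  rewrite -mulrA e_ba ew (eqP w_alpha) rmorph0 add0r.
  by exists v => //; rewrite mulrCA mulVKf // mulrC.
have s1 : vle V 1 s by apply: (not_mem_vle hV) => //; apply: (vle_refl hV).
apply: (@vle_trans _ _ _ _ hV ((s * b) ^+ (q * Q ^ C))); last exact: (vleX hV).
rewrite exprMn; apply: (vleM hV); last exact: (vle_refl hV).
by apply: (vleXl1 hV s1); apply: exp_ge_id.
Qed.

(** A reduced numerator or denominator of [b / a] with a root would give a
    capacity gap at that root. *)
Lemma ratio_constant a b (S : set E) : ratl t a -> ratl t b -> a != 0 -> b != 0 ->
  infinite_set S -> (forall l, S l -> torsion l a /\ torsion l b) ->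
  exists c, b = kappa c * a.
Proof.
move=> ta tb a0 b0 infS Sab.
have [w [u [u0 e]]] := ratlM tb (ratlV ta).
have w0 : w != 0.
  apply: contra_neq (mulf_neq0 b0 (invr_neq0 a0)) => w0.
  by rewrite e w0 rmorph0 horner0 mul0r.
have vu0 : u != 0 by apply: contraNneq u0 => ->; rewrite rmorph0 horner0.
pose g := gcdp w u; pose w' := w %/ g; pose u' := u %/ g.
have ew : w = w' * g by rewrite divpK // dvdp_gcdl.
have eu : u = u' * g by rewrite divpK // dvdp_gcdr.
have cop : coprimep w' u' by apply: coprimep_div_gcd; rewrite w0.
have e_ba : b * (map_poly kappa u').[t] = a * (map_poly kappa w').[t].
  have g0 : (map_poly kappa g).[t] != 0.
    by apply: contraNneq u0 => g0; rewrite eu rmorphM hornerM g0 mulr0.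
  apply: (mulIf g0); rewrite -!mulrA -!hornerM -!rmorphM -eu -ew.
  apply: (mulIf (invr_neq0 a0)); rewrite mulrAC e divfK //.
  by rewrite [a * _]mulrC mulfK.
have no_root (p p' : {poly k}) :
    coprimep p p' -> (forall x, root p x -> ~~ root p' x -> False) ->
    exists2 c, c != 0 & p = c%:P.
  move=> cpp np; have [s1|/closed_rootP[x px]] := eqVneq (size p) 1%N.
    move/eqP/size_poly1P: s1 => [c c0 ->]; by exists c.
  by exfalso; apply: (np x px); apply: coprimep_root px.
have [x wx ux|c c0 ec] := no_root _ _ cop.
  by apply: infS; apply: ratio_zero_finite ta a0 b0 e_ba wx ux Sab.
have [||d d0 ed] := no_root u' w'; first by rewrite coprimep_sym.
  move=> x ux wx; apply: infS; apply: (ratio_zero_finite tb b0 a0 (esym e_ba) ux wx).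
  by move=> l /Sab[].
exists (c / d); move: e_ba; rewrite ec ed !map_polyC !hornerC /= => e_ba.
have kd0 : kappa d != 0 by rewrite fmorph_eq0.
by rewrite rmorphM fmorphV /= mulrAC [kappa c * a]mulrC -e_ba mulfK.
Qed.

Section ConstantRatio.
Variables (c : k) (a : E).

(** Eliminating the parameter [l] between [phi l a] and [phi l (c a)]. *)
Lemma phi_cst_diff l : kappa c ^+ q * phi l a - phi l (kappa c * a)
  = kappa (c ^+ q - c) * (t * a) + kappa (c ^+ q - c ^+ Q) * a ^+ Q.
Proof. by rewrite /phi !exprMn !rmorphB !rmorphXn; ring. Qed.

Lemma phi_parameter l : l * a ^+ q = phi l a - (t * a + a ^+ Q).
Proof. by rewrite /phi; ring. Qed.

Lemma torsion_diff_vle V l rho : valuation_ring kappa V ->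
  torsion l a -> torsion l (kappa c * a) ->
  (forall x, torsion l x -> vle V x rho) ->
  vle V (kappa (c ^+ q - c) * (t * a) + kappa (c ^+ q - c ^+ Q) * a ^+ Q) rho.
Proof.
move=> hV ta tb bd; rewrite -(phi_cst_diff l) -rmorphXn /=; apply: (vleB hV).
  by apply: (vle_trans hV (vle_cstM hV _ _)); apply/bd/torsion_phi.
by apply/bd/torsion_phi.
Qed.

(** At a pole of [a] all torsion is bounded by [a], because [l] is at most
    [a^(Q - q)]; but the combination of [phi_cst_diff] has the size of [a^Q]. *)
Lemma no_common_at_pole V l : valuation_ring kappa V -> ~ V a -> vle V t a ->
  c ^+ Q != c ^+ q -> torsion l a -> torsion l (kappa c * a) -> False.
Proof.
move=> hV Va t_a cQ ta tb.
have a1 : vle V 1 a by apply: (not_mem_vle hV) => //; apply: (vle_refl hV).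
have a0 := not_mem_neq0 hV Va.
have mono := vleXl1 hV a1.
have big m n : (m < n)%N -> ~ vle V (a ^+ n) (a ^+ m).
  by move=> lt_mn /(vle_exp_le1 hV lt_mn)/(vle1 V).
have [rho e_rho] : exists rho, rho ^+ (Q - q) = l by apply: closed_root_exp; lia.
have ta2 : vle V (t * a) (a ^+ 2) by rewrite expr2; apply: (vleM hV) => //; apply: (vle_refl hV).
have rho_a : vle V rho a.
  case: (vle_total hV rho a) => // a_rho.
  have rho1 := vle_trans hV a1 a_rho.
  have rho0 : rho != 0.
    by apply: contraPneq rho1 => -> [v _]; rewrite mulr0; apply/eqP/oner_neq0.
  have phi_rho : vle V (phi l a) rho.
    apply: (torsion_vle hV rho1 _ _ (torsion_phi ta)).
      by rewrite e_rho; apply: (vle_refl hV).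
    by apply: (vle_trans hV t_a); apply: (vle_trans hV a_rho); apply: (vle_expl hV) => //; lia.
  have [h|h] := vleD_or hV (phi l a) (- (t * a + a ^+ Q)); rewrite -phi_parameter in h.
    exfalso; apply: (big 0%N q); first lia.
    apply: (@vle_mul2r _ _ (rho ^+ (Q - q))); first exact: expf_neq0.
    rewrite expr0 mul1r mulrC e_rho; apply: (vle_trans hV h); apply: (vle_trans hV phi_rho).
    by rewrite -e_rho; apply: (vle_expl hV) => //; lia.
  apply: (vle_exp_mono hV (_ : 0 < Q - q)%N); first lia.
  apply: (@vle_mul2r _ _ (a ^+ q)); first exact: expf_neq0.
  rewrite -exprD subnK; last lia.
  rewrite e_rho; apply: (vle_trans hV h); apply: (vleN hV); apply: (vleD hV); last exact: (vle_refl hV).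
  by apply: (vle_trans hV ta2); apply: mono; lia.
have bd x : torsion l x -> vle V x a.
  apply: (torsion_vle hV a1); first by rewrite -e_rho; apply: (vleX hV).
  by apply: (vle_trans hV t_a); apply: (vle_expl hV) => //; lia.
apply: (big 2 Q); first lia.
apply: (@vle_cstMK _ _ _ _ hV (c ^+ q - c ^+ Q)); first by rewrite subr_eq0 eq_sym.
rewrite -[X in vle V X _](addKr (kappa (c ^+ q - c) * (t * a))) addrC.
apply: (vleB hV); last exact: (vle_trans hV (vle_cstM hV _ _)).
apply: (vle_trans hV (torsion_diff_vle hV ta tb bd)).
by rewrite -[X in vle V X _]expr1; apply: mono.
Qed.

(** For a constant [a] the place [t = oo] is used. With [tau^(Q - q) = t], all
    torsion is bounded by [tau]; but the combination of [phi_cst_diff] has the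
    size of [t]. *)
Lemma no_common_constant a' l : a = kappa a' -> a != 0 ->
  c ^+ Q != c ^+ q -> torsion l a -> torsion l (kappa c * a) -> False.
Proof.
move=> ea a0 cQ ta tb.
have [V hV Vt] := valuation_ring_omitting kt.
have a'0 : a' != 0 by rewrite -(fmorph_eq0 kappa) -ea.
have cq : c ^+ q != c.
  apply: contra_neq cQ => cq; rewrite cq Q_q.
  by elim: r => [|n IHn]; rewrite ?expn0 ?expr1 // expnS exprM cq.
have t1 : vle V 1 t by apply: (not_mem_vle hV) => //; apply: (vle_refl hV).
have acst n x : vle V (x * a ^+ n) x.
  by rewrite mulrC ea -rmorphXn /=; apply: (vle_cstM hV).
have acstK n x y : vle V (x * a ^+ n) y -> vle V x y.
  by rewrite mulrC ea -rmorphXn /=; apply: (vle_cstMK hV); rewrite expf_neq0.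
have [tau e_tau] : exists tau, tau ^+ (Q - q) = t by apply: closed_root_exp; lia.
have [rho e_rho] : exists rho, rho ^+ (Q - q) = l by apply: closed_root_exp; lia.
have Qq0 : (0 < Q - q)%N by lia.
have tau1 : vle V 1 tau by apply: (vle_exp_mono hV Qq0); rewrite expr1n e_tau.
have small y : vle V (y ^+ (Q - q)) y -> vle V y 1.
  by move=> h; apply: (vle_exp_le1 hV (_ : 1 < Q - q)%N); [lia | rewrite expr1].
have t_pow y : vle V 1 y -> vle V tau y -> vle V t (y ^+ (Q - 1)).
  move=> y1 tau_y; rewrite -e_tau; apply: (vle_trans hV (vleX hV _ tau_y)).
  by apply: (vleXl1 hV y1); lia.
have rho_tau : vle V rho tau.
  case: (vle_total hV rho tau) => // tau_rho.
  have rho1 := vle_trans hV tau1 tau_rho.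
  have phi_rho : vle V (phi l a) rho.
    apply: (torsion_vle hV rho1 _ (t_pow _ rho1 tau_rho) (torsion_phi ta)).
    by rewrite e_rho; apply: (vle_refl hV).
  have [h|h] := vleD_or hV (phi l a) (- (t * a + a ^+ Q)); rewrite -phi_parameter in h.
    apply: (vle_trans hV _ tau1); apply: small; rewrite e_rho.
    exact: (acstK q _ _ (vle_trans hV h phi_rho)).
  apply: (vle_exp_mono hV Qq0); rewrite e_rho e_tau; apply: (acstK q _ _ (vle_trans hV h _)).
  apply: (vleN hV); apply: (vleD hV); first exact: (acst 1%N).
  by apply: (vle_trans hV _ t1); rewrite -[a ^+ Q]mul1r; apply: acst.
have bd x : torsion l x -> vle V x tau.
  apply: (torsion_vle hV tau1); last by apply: t_pow => //; apply: (vle_refl hV).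
  by rewrite -e_rho; apply: (vleX hV).
apply: Vt; apply/(vle1 V); rewrite -e_tau -(expr1n _ (Q - q)); apply: (vleX hV).
apply: small; rewrite e_tau; apply: (acstK 1%N); rewrite expr1.
apply: (@vle_cstMK _ _ _ _ hV (c ^+ q - c)); first by rewrite subr_eq0.
rewrite -[X in vle V X _](addrK (kappa (c ^+ q - c ^+ Q) * a ^+ Q)).
apply: (vleB hV); first exact: torsion_diff_vle bd.
apply: (vle_trans hV (acst _ _)); exact: (vle_trans hV (vle_cst hV _)).
Qed.

Lemma no_common_torsion l : ratl t a -> a != 0 ->
  c ^+ Q != c ^+ q -> torsion l a -> torsion l (kappa c * a) -> False.
Proof.
move=> ra a0 cQ ta tb.
case: (pselect (range kappa a)) => [[a' _ ea]|ka].
  exact: (no_common_constant (esym ea) a0 cQ ta tb).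
have [V hV Va] := valuation_ring_omitting ka.
apply: (no_common_at_pole hV Va _ cQ ta tb).
case: (pselect (V t)) => [Vt|Vt]; first by apply: (not_mem_vle hV) => //; apply/(vle1 V).
have t1 : vle V 1 t by apply: (not_mem_vle hV) => //; apply: (vle_refl hV).
have [u [v [v0 ea]]] := ra.
have vp0 : v != 0 by apply: contraNneq v0 => ->; rewrite rmorph0 horner0.
have up0 : u != 0 by apply: contraNneq a0 => u0; rewrite ea u0 rmorph0 horner0 mul0r.
apply: (vle_mul2r v0); rewrite ea divfK //.
have [le_uv|lt_vu] := leqP (size u).-1 (size v).-1.
  exfalso; apply: Va; apply/(vle1 V); apply: (vle_mul2r v0); rewrite ea divfK // mul1r.
  apply: (vle_trans hV (vle_horner_cst hV u Vt)).
  by apply: (vle_trans hV _ (vge_horner_cst hV Vt vp0)); apply: (vleXl1 hV t1).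
apply: (vle_trans hV (vleM hV (vle_refl hV t) (vle_horner_cst hV v Vt))).
rewrite -exprS; apply: (vle_trans hV _ (vge_horner_cst hV Vt up0)).
exact: (vleXl1 hV t1).
Qed.

Let gamma n := kappa (c ^+ (q ^ n)).
(** When [c^Q = c^q] the leading coefficients in [l] of [phi_l^n(c a)] and of
    [phi_l^n(a)] have the ratio [gamma n]; so this combination has smaller degree,
    and it is still bounded on common torsion parameters. *)
Let diff_poly n := gamma n *: orbit_poly a n - orbit_poly (kappa c * a) n.

(** Both [x -> x^q] and [x -> x^Q] send [gamma n] to [gamma n.+1], so only the
    linear term of [phi_poly] fails to commute with the combination. *)
Lemma diff_polyS n : c ^+ Q = c ^+ q ->
  diff_poly n.+1 = (t * (gamma n.+1 - gamma n)) *: orbit_poly a n + phi_poly (diff_poly n).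
Proof.
move=> cQ.
have pE m : [pchar E].-nat m -> [pchar {poly E}].-nat m.
  by rewrite (eq_pnat _ (pchar_poly E)).
have gq : gamma n ^+ q = gamma n.+1 by rewrite /gamma -rmorphXn /= -exprM -expnSr.
have gQ : gamma n ^+ Q = gamma n.+1.
  by rewrite /gamma -rmorphXn /= -exprM mulnC exprM cQ -exprM -expnS.
rewrite /diff_poly /= -!/(orbit_poly _ n) /phi_poly.
rewrite !exprDn_pchar ?pE ?E_Q // !exprNn_pchar ?pE ?E_Q // !exprZn gq gQ.
rewrite -!mul_polyC !rmorphM !rmorphB /=; ring.
Qed.

Hypotheses (cQ : c ^+ Q = c ^+ q) (cq : c ^+ q != c) (a0 : a != 0).

(** The degree drops from [Q^(n+1)] to [Q^n] while the leading coefficient gains the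
    factor [mu], which starts as a multiple of [t + t^q] and is then raised to
    the power [Q] at each step, up to a term linear in [t]. *)
Lemma size_lead_diff_poly n : exists mu,
  [/\ size (diff_poly n.+2) = (Q ^ n).+1,
    lead_coef (diff_poly n.+2) = mu * (a ^+ q) ^+ (Q ^ n) &
    forall V, valuation_ring kappa V -> ~ V t -> vle V (t ^+ (q * Q ^ n)) mu].
Proof.
have add m (p1 p2 : {poly E}) : size p1 = m.+1 -> size p2 = m.+1 ->
    lead_coef p1 + lead_coef p2 != 0 ->
    size (p1 + p2) = m.+1 /\ lead_coef (p1 + p2) = lead_coef p1 + lead_coef p2.
  rewrite !lead_coefE => s1 s2; rewrite s1 s2 /= -coefD => nz.
  suff s12 : size (p1 + p2) = m.+1 by rewrite s12.
  apply/eqP; rewrite eqn_leq (leq_trans (size_polyD _ _)) ?s1 ?s2 ?maxnn //=.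
  by rewrite ltnNge; apply: contraNN nz => le_m; rewrite nth_default.
have gD m : gamma m.+1 - gamma m = kappa ((c ^+ q - c) ^+ (q ^ m)).
  have k_q : [pchar k].-nat (q ^ m)%N.
    by rewrite pnatX -(eq_pnat _ (fmorph_pchar kappa)) E_q.
  rewrite exprDn_pchar // exprNn_pchar // -exprM -expnS rmorphB.
  by rewrite /gamma expnS.
have g0 m : gamma m.+1 - gamma m != 0.
  by rewrite gD fmorph_eq0 expf_neq0 // subr_eq0.
have t0 : t != 0.
  by apply: contraPneq kt => ->; apply; exists 0; rewrite ?rmorph0.
have [V0 hV0 V0t] := valuation_ring_omitting kt.
have nz mu m : (forall V, valuation_ring kappa V -> ~ V t -> vle V (t ^+ m) mu) ->
    mu != 0.
  move=> h; apply/eqP => mu0; have [v _] := h V0 hV0 V0t.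
  by rewrite mu0 mulr0 => /eqP; rewrite (negPf (expf_neq0 _ t0)).
(* the t-linear correction cannot cancel the larger power of t *)
have dom V z w m : valuation_ring kappa V -> ~ V t -> (1 < m)%N ->
    vle V w t -> vle V (t ^+ m) (z - w) -> vle V (t ^+ m) z.
  move=> hV Vt m1 w_t h; have [e|e] := vleD_or hV z (- w).
    exact: (vle_trans hV h e).
  have t_m : vle V (t ^+ m) (t ^+ 1).
    rewrite expr1; apply: (vle_trans hV h); apply: (vle_trans hV e).
    exact: (vleN hV).
  by exfalso; apply: Vt; apply/(vle1 V); apply: (vle_exp_le1 hV m1 t_m).
have corr V m : valuation_ring kappa V -> vle V (t * (gamma m.+1 - gamma m)) t.
  by move=> hV; rewrite gD mulrC; apply: (vle_cstM hV).
have scale_orbit m l : size ((t * (gamma l.+1 - gamma l)) *: orbit_poly a m.+1) = (Q ^ m).+1 /\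
    lead_coef ((t * (gamma l.+1 - gamma l)) *: orbit_poly a m.+1)
      = t * (gamma l.+1 - gamma l) * (a ^+ q) ^+ (Q ^ m).
  have [sx lx] := size_lead_orbit_poly m a0.
  by rewrite size_scale ?sx ?lead_coefZ ?lx // mulf_neq0.
elim: n => [|n [mu [sY lY mu_big]]].
  pose y := t * (gamma 1 - gamma 0) * a.
  have y0 : y != 0 by rewrite !mulf_neq0.
  have eY1 : diff_poly 1 = y%:P.
    rewrite diff_polyS //.
    have -> : diff_poly 0 = 0.
      by rewrite /diff_poly /orbit_poly /gamma /= expn0 expr1 -mul_polyC -polyCM subrr.
    by rewrite /phi_poly scaler0 !expr0n !gtn_eqF ?mulr0 ?addr0 -?mul_polyC -?polyCM //; lia.
  pose mu := (t + t ^+ q) * (gamma 2 - gamma 1).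
  have mu_big V : valuation_ring kappa V -> ~ V t -> vle V (t ^+ (q * Q ^ 0)) mu.
    move=> hV Vt; rewrite expn0 muln1; apply: (dom V mu (t * (gamma 2 - gamma 1))) => //.
      exact: corr.
    rewrite /mu mulrDl addrC addKr mulrC.
    have [v [Vv ev]] : exists v, V v /\ v * (gamma 2 - gamma 1) = 1.
      exists (kappa ((c ^+ q - c) ^+ (q ^ 1))^-1); split; first exact: (subring_cst hV).
      by rewrite gD -rmorphM mulVf ?rmorph1 // expf_neq0 // subr_eq0.
    by exists v => //; rewrite mulrA ev mul1r.
  have [s1 l1] := scale_orbit 0%N 1%N; have [s2 l2] := size_lead_phi_polyC y0.
  have e_lead : lead_coef ((t * (gamma 2 - gamma 1)) *: orbit_poly a 1)
      + lead_coef (phi_poly y%:P) = mu * (a ^+ q) ^+ (Q ^ 0).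
    rewrite l1 l2 expn0 expr1 /y !exprMn.
    have -> : (gamma 1 - gamma 0) ^+ q = gamma 2 - gamma 1.
      by rewrite !gD -rmorphXn /= -exprM expn0 mul1n.
    by rewrite /mu; ring.
  have [sS lS] : size (diff_poly 2) = 2 /\ lead_coef (diff_poly 2) = mu * (a ^+ q) ^+ (Q ^ 0).
    rewrite diff_polyS // eY1 -e_lead; apply: add => //.
    by rewrite e_lead mulf_neq0 ?expf_neq0 ?(nz _ _ mu_big).
  by exists mu.
have Qn0 : (0 < Q ^ n)%N by rewrite expn_gt0; apply/orP; left; lia.
pose mu' := mu ^+ Q + t * (gamma n.+3 - gamma n.+2).
have mu'_big V : valuation_ring kappa V -> ~ V t -> vle V (t ^+ (q * Q ^ n.+1)) mu'.
  move=> hV Vt; apply: (dom V mu' (t * (gamma n.+3 - gamma n.+2))) => //.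
  - rewrite expnS; nia.
  - exact: corr.
  by rewrite /mu' addrK expnSr mulnA exprM; apply: (vleX hV); apply: mu_big.
have [s1 l1] := scale_orbit n.+1 n.+2; have [s2 l2] := size_lead_phi_poly Qn0 sY.
rewrite -expnSr in s2.
have e_lead : lead_coef ((t * (gamma n.+3 - gamma n.+2)) *: orbit_poly a n.+2)
    + lead_coef (phi_poly (diff_poly n.+2)) = mu' * (a ^+ q) ^+ (Q ^ n.+1).
  by rewrite l1 l2 lY exprMn -[_ ^+ (Q ^ n) ^+ Q]exprM -expnSr /mu'; ring.
have [sS lS] : size (diff_poly n.+3) = (Q ^ n.+1).+1 /\
    lead_coef (diff_poly n.+3) = mu' * (a ^+ q) ^+ (Q ^ n.+1).
  rewrite diff_polyS // -e_lead; apply: add => //.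
  by rewrite e_lead mulf_neq0 ?expf_neq0 ?(nz _ _ mu'_big).
by exists mu'.
Qed.

Lemma constant_ratio_finite (S : set E) : ratl t a ->
  (forall l, S l -> torsion l a /\ torsion l (kappa c * a)) -> finite_set S.
Proof.
move=> ra Sab; apply: (capacity_gap_torsion kt (ratl_id t) ra a0).
  by move=> l /Sab[].
move=> C; exists (Q ^ C)%N, (orbit_poly a C.+1), (diff_poly C.+2).
have [sA lA] := size_lead_orbit_poly C a0.
have [mu [sB lB mu_big]] := size_lead_diff_poly C.
split=> //.
- by rewrite expn_gt0; apply/orP; left; lia.
- move=> V l hV /Sab[ta _]; exists (iter C.+1 (phi l) a); first exact: torsion_iter.
  by rewrite horner_orbit_poly; apply: (vle_refl hV).
- move=> V l hV /Sab[ta tb]; rewrite hornerD hornerN hornerZ !horner_orbit_poly.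
  have hx := torsion_iter C.+2 ta; have hy := torsion_iter C.+2 tb.
  set x := iter _ _ a in hx *; set y := iter _ _ (kappa c * a) in hy *.
  have cx : vle V (gamma C.+2 * x) x by apply: (vle_cstM hV).
  case: (vle_total hV x y) => h.
    by exists y => //; apply: (vleB hV (vle_trans hV cx h)); apply: (vle_refl hV).
  by exists x => //; apply: (vleB hV cx h).
move=> V hV Vt; rewrite lA lB; apply: (vleM hV); last exact: (vle_refl hV).
apply: (vle_trans hV _ (mu_big V hV Vt)).
have t1 : vle V 1 t by apply: (not_mem_vle hV) => //; apply: (vle_refl hV).
by apply: (vleXl1 hV t1); apply: exp_ge_id.
Qed.

End ConstantRatio.

(** The ratio is first constant, then satisfies [c^Q = c^q], then [c^q = c]; each
    step discards an alternative with finitely many common parameters. *)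
Theorem common_torsion_dependent a b (S : set E) : #|F| = q ->
  ratl t a -> ratl t b -> a != 0 -> b != 0 ->
  infinite_set S -> (forall l, S l -> torsion l a /\ torsion l b) ->
  exists d : F, b = kappa (iota d) * a.
Proof.
move=> F_card ra rb a0 b0 infS Sab.
have [c eb] := ratio_constant ra rb a0 b0 infS Sab.
have Sca l : S l -> torsion l a /\ torsion l (kappa c * a) by rewrite -eb; apply: Sab.
have [cQ|cQ] := eqVneq (c ^+ Q) (c ^+ q); last first.
  case: infS; rewrite (_ : S = set0); first exact: finite_set0.
  apply/seteqP; split=> // l /Sca[ta tb]; exact: (no_common_torsion ra a0 cQ ta tb).
have [cq|cq] := eqVneq (c ^+ q) c; last first.
  by case: infS; exact: (constant_ratio_finite cQ cq a0 ra Sca).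
have : root (map_poly iota ('X^#|F| - 'X)) c.
  by rewrite rmorphB /= map_polyXn map_polyX /root !hornerE F_card cq subrr.
rewrite finField_genPoly rmorph_prod /root horner_prod prodf_seq_eq0.
move=> /hasP[d _ /=]; rewrite rmorphB /= map_polyX map_polyC hornerXsubC subr_eq0.
by move=> /eqP ec; exists d; rewrite -ec.
Qed.

End Dynamics.

(** * Drinfeld modules and their specializations *)

Lemma fraction_eq (R : idomainType) (x : {fraction R}) :
  exists n d : R, d != 0 /\ x = tofrac n / tofrac d.
Proof.
pose y := generic_quotient.repr x; exists (frac y).1, (frac y).2.
have d0 : (frac y).2 != 0 by exact: denom_ratioP.
split=> //; apply: (canRL (mulfK _)); first by rewrite tofrac_eq0.
rewrite -[x]generic_quotient.reprK -/y; unlock FracField.tofrac.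
rewrite -[LHS]FracField.pi_mul; apply/generic_quotient.eqmodP => /=.
rewrite FracField.equivfE /FracField.mulf /= !numden_Ratio ?oner_neq0 ?mulr1 //.
by rewrite mulrC.
Qed.

Section Specialization.
Variables (F : finFieldType) (L : fieldType) (gamma : {rmorphism {poly F} -> L}) (r : nat).
Variables (Psi : drinfeldModule gamma r) (f : L -> L).
Hypothesis Psi_X : forall x, (Psi 'X).[x] = f x.

Lemma drinfeld0 : Psi 0 = 0.
Proof. by apply: (addrI (Psi 0)); rewrite -drinfeldD !addr0. Qed.

Lemma drinfeld_horner n (a : {poly F}) x : (size a <= n)%N ->
  (Psi a).[x] = \sum_(i < n) gamma (a`_i)%:P * iter i f x.
Proof.
elim: n => [|n IHn] in a x *.
  by rewrite leqn0 size_poly_eq0 => /eqP ->; rewrite drinfeld0 horner0 big_ord0.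
move=> sa.
have ea : a = drop_poly 1 a * 'X + (a`_0)%:P.
  rewrite -{1}(poly_take_drop 1 a) expr1 addrC; congr (_ + _).
  by rewrite (size1_polyC (size_take_poly 1 a)) coef_take_poly.
rewrite big_ord_recl /= addrC {1}ea drinfeldD drinfeldM drinfeldC.
rewrite hornerD horner_comp hornerZ hornerX Psi_X; congr (_ + _).
rewrite IHn; last by rewrite size_drop_poly leq_subLR add1n.
by apply: eq_bigr => i _; rewrite coef_drop_poly addn1 -iterSr.
Qed.

Lemma drinfeld_root_cst (c : F) a x : root (Psi a) x -> root (Psi a) (gamma c%:P * x).
Proof.
have comm : (Psi (a * c%:P)).[x] = (Psi (c%:P * a)).[x] by rewrite mulrC.
move: comm; rewrite !drinfeldM drinfeldC !horner_comp !hornerZ !hornerX.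
by rewrite /root => -> /eqP ->; rewrite mulr0.
Qed.

Lemma drinfeld_root0 a : root (Psi a) 0.
Proof.
have e : (Psi (a * 0%:P)).[0] = 0 by rewrite mulr0 drinfeld0 horner0.
move: e; rewrite drinfeldM drinfeldC horner_comp hornerZ hornerX mulr0.
by move/eqP.
Qed.

Lemma drinfeld_rootMl a b x : root (Psi b) x -> root (Psi (a * b)) x.
Proof.
by rewrite /root drinfeldM horner_comp => /eqP ->; apply: drinfeld_root0.
Qed.

Lemma drinfeld_rootMr a b x : root (Psi a) x -> root (Psi (a * b)) x.
Proof. by rewrite mulrC; apply: drinfeld_rootMl. Qed.

Lemma drinfeld_torsion_cst (c : F) x :
  drinfeld_torsion Psi x -> drinfeld_torsion Psi (gamma c%:P * x).
Proof. by move=> [a a0 ax]; exists a => //; apply: drinfeld_root_cst. Qed.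

Lemma drinfeld_torsion0 : drinfeld_torsion Psi 0.
Proof. by exists 1; [apply: oner_neq0 | apply: drinfeld_root0]. Qed.

End Specialization.

(** The substitution [z = lambda] is visible on [Phi_t], whose coefficients determine
    their polynomial lift since [K[z]] embeds in [K(z)]. *)
Lemma specialization_X (F : finFieldType) (K : fieldType) (M : closedFieldType)
    (j : {rmorphism K -> M})
    (gammaK : {rmorphism {poly F} -> K}) (r m n : nat) (lambda : M)
    (Phi : drinfeldModule (gamma_ratz gammaK) r)
    (Psi : drinfeldModule (gamma_ext gammaK j) r) :
  Phi 'X = gamma_ratz gammaK 'X *: 'X + tofrac 'X *: 'X^m + 'X^n ->
  is_specialization j lambda Phi Psi ->
  forall x, (Psi 'X).[x] = phi (j (gammaK 'X)) m n lambda x.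
Proof.
move=> ePhi /(_ 'X) [P [eP ->]] x.
have -> : P = (gammaK 'X)%:P *: 'X + 'X *: 'X^m + 'X^n.
  apply: (map_inj_poly (f := @tofrac {poly K})) => [u v /eqP||]; first 1 last.
  - exact: rmorph0.
  - rewrite -eP ePhi !rmorphD /= !map_polyZ map_polyX !map_polyXn //.
  by rewrite tofrac_eq => /eqP.
rewrite !rmorphD /= !map_polyZ map_polyX !map_polyXn /= !hornerE /phi /=.
by rewrite map_polyC map_polyX /= /horner_eval !hornerE.
Qed.

Section Converse.
Variables (F : finFieldType) (M : closedFieldType) (gamma : {rmorphism {poly F} -> M}).
Variables (r q Q : nat) (t : M) (Phis : M -> drinfeldModule gamma r).
Hypothesis Phis_X : forall l x, (Phis l 'X).[x] = phi t q Q l x.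
Hypotheses (q_gt1 : (1 < q)%N) (le_q2Q : (2 * q <= Q)%N).

(** If all torsion parameters of [b] were killed by one [A], then so would be
    the root of the polynomial in [l] that expresses [Phi_(t A + 1)(b) = 0],
    although [A] and [t A + 1] are coprime. *)
Lemma torsion_parameters_infinite_neq0 b : b != 0 ->
  infinite_set [set l | drinfeld_torsion (Phis l) b].
Proof.
move=> b0 /finite_seqP[s eS].
have [A A0 killed] : exists2 A, A != 0 & forall l, l \in s -> root (Phis l A) b.
  have : forall l, l \in s -> drinfeld_torsion (Phis l) b.
    by move=> l ls; have : [set` s] l by []; rewrite -eS.
  elim: s {eS} => [_|l s IHs tors]; first by exists 1; rewrite ?oner_neq0.
  have [|A A0 killed] := IHs; first by move=> l' ls; apply: tors; rewrite inE ls orbT.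
  have [|B B0 killedB] := tors l; first by rewrite inE eqxx.
  exists (B * A); first exact: mulf_neq0.
  move=> l'; rewrite inE => /predU1P[->|/killed]; first exact: drinfeld_rootMr.
  exact: drinfeld_rootMl.
pose c := 'X * A + 1.
have sXA : size ('X * A) = (size A).+1 by rewrite mulrC size_mulX.
have sc : size c = (size A).+1.
  by rewrite size_polyDl // sXA size_poly1 ltnS size_poly_gt0.
have [n sA] : exists n, size A = n.+1 by exists (size A).-1; rewrite prednK // size_poly_gt0.
pose R := \sum_(i < n.+2) gamma (c`_i)%:P *: orbit_poly t q Q b i.
have size_orbit i : size (orbit_poly t q Q b i.+1) = (Q ^ i).+1.
  by case: (size_lead_orbit_poly t q_gt1 le_q2Q i b0).
have Q1 : (1 < Q)%N by lia.
have Qn0 : (0 < Q ^ n)%N by rewrite expn_gt0; apply/orP; left; lia.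
have sR : size R = (Q ^ n).+1.
  have top0 : gamma (c`_n.+1)%:P != 0.
    rewrite -(rmorph0 gamma) (inj_eq (drinfeld_generic (Phis 0))) polyC_eq0.
    by rewrite -[n.+1]/(n.+2.-1) -sA -sc -lead_coefE lead_coef_eq0 -size_poly_eq0 sc.
  have top : size (gamma (c`_n.+1)%:P *: orbit_poly t q Q b n.+1) = (Q ^ n).+1.
    by rewrite size_scale.
  rewrite /R big_ord_recr /= addrC size_polyDl top //.
  rewrite ltnS; apply: leq_trans (size_sum _ _ _) _; apply/bigmax_leqP => i _.
  apply: leq_trans (size_scale_leq _ _) _; case: i => [[|i] lt_i] /=.
    by rewrite (leq_trans (size_polyC_leq1 _)).
  by rewrite size_orbit ltn_exp2l.
have /closed_rootP[l] : size R != 1%N by rewrite sR eqSS -lt0n.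
rewrite /root horner_sum => /eqP Rl.
have cl : (Phis l c).[b] = 0.
  rewrite (drinfeld_horner (Phis_X l) _ (n := n.+2)) ?sc ?sA //.
  by apply: etrans Rl; apply: eq_bigr => i _; rewrite hornerZ horner_orbit_poly.
have c0 : c != 0 by rewrite -size_poly_eq0 sc.
have : [set l | drinfeld_torsion (Phis l) b] l by exists c => //; apply/eqP.
rewrite eS => /killed; rewrite /root => /eqP Al.
move: cl; rewrite drinfeldD drinfeldM hornerD horner_comp Al (eqP (drinfeld_root0 _ _)) add0r.
by rewrite -polyC1 drinfeldC polyC1 rmorph1 scale1r hornerX; apply/eqP.
Qed.

Lemma torsion_parameters_infinite b :
  infinite_set [set l | drinfeld_torsion (Phis l) b].
Proof.
have [->|] := eqVneq b 0; last exact: torsion_parameters_infinite_neq0.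
apply: sub_infinite_set (torsion_parameters_infinite_neq0 (oner_neq0 M)) => l _.
exact: drinfeld_torsion0.
Qed.

End Converse.

Theorem theorem1p5
    (p e q r : nat) (hp : prime p) (he : (0 < e)%N) (hq : q = (p ^ e)%N)
    (hr : (2 <= r)%N)
    (* F_q and an algebraic closure k of F_q *)
    (F : finFieldType) (hF : #|F| = q)
    (k : closedFieldType) (iota : {rmorphism F -> k})
    (hk : is_algebraic_closure iota)
    (* an algebraic closure of K = k(t) *)
    (Kbar : closedFieldType) (j : {rmorphism {fraction {poly k}} -> Kbar})
    (hKbar : is_algebraic_closure j)
    (a b : {fraction {poly k}})
    (* the family Phi over K(z) and its specializations *)
    (Phi : drinfeldModule (gamma_ratz (gamma_rat iota)) r)
    (hPhi : Phi 'X = gamma_ratz (gamma_rat iota) 'X *: 'X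
                     + tofrac 'X *: 'X^q + 'X^(q ^ r))
    (Phis : Kbar -> drinfeldModule (gamma_ext (gamma_rat iota) j) r)
    (hPhis : forall lambda : Kbar,
       is_specialization j lambda Phi (Phis lambda)) :
  infinite_set [set lambda : Kbar | drinfeld_torsion (Phis lambda) (j a)
                                 /\ drinfeld_torsion (Phis lambda) (j b)]
  <-> exists c d : F, (c != 0) || (d != 0) /\
        gamma_rat iota c%:P * a + gamma_rat iota d%:P * b = 0.
Proof.
pose Q := (q ^ r)%N.
pose t := j (gamma_rat iota 'X).
have Phis_X l x : (Phis l 'X).[x] = phi t q Q l x.
  exact: specialization_X hPhi (hPhis l) x.
have q_gt1 : (1 < q)%N.
  by rewrite hq -(exp1n e) ltn_exp2r // prime_gt1.
have le_q2Q : (2 * q <= Q)%N.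
  apply: (@leq_trans (q ^ 2)); first by rewrite expnS expn1 leq_mul2r q_gt1 orbT.
  by rewrite leq_exp2l.
have infinite_torsion x : infinite_set [set l | drinfeld_torsion (Phis l) x].
  exact: (torsion_parameters_infinite Phis_X q_gt1 le_q2Q).
pose g := gamma_rat iota.
have g_inj : injective (fun c : F => g c%:P).
  move=> c d /eqP; rewrite /g /gamma_rat /= tofrac_eq !map_polyC /= => /eqP/polyC_inj.
  exact: fmorph_inj.
have g_neq0 c : c != 0 -> g c%:P != 0.
  by apply: contra_neq => g0; apply: g_inj; rewrite g0 polyC0 rmorph0.
have g_div c d : d != 0 -> g (c / d)%:P = g c%:P / g d%:P.
  move=> d0; apply: (canRL (mulfK (g_neq0 _ d0))).
  by rewrite -rmorphM -polyCM divfK.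
split; last first.
  have dependent c d x y : c != 0 -> g c%:P * x + g d%:P * y = 0 ->
      infinite_set [set l | drinfeld_torsion (Phis l) (j x) /\
                            drinfeld_torsion (Phis l) (j y)].
    move=> c0 rel; apply: sub_infinite_set (infinite_torsion (j y)) => l ty; split=> //.
    have -> : x = g (- d / c)%:P * y.
      rewrite g_div // polyCN rmorphN mulrAC mulNr; apply: (canRL (mulfK (g_neq0 _ c0))).
      by rewrite mulrC; apply/eqP; rewrite -addr_eq0 rel.
    rewrite rmorphM.
    exact: drinfeld_torsion_cst.
  move=> [c [d [/orP[c0|d0] rel]]]; first exact: dependent c0 rel.
  apply: sub_infinite_set (dependent d c b a d0 _) => [l []|] //.
  by rewrite addrC.
move=> infS.
have [->|a0] := eqVneq a 0.
  by exists 1, 0; rewrite oner_neq0 polyC0 rmorph0 mulr0 mul0r addr0.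
have ja0 : j a != 0 by rewrite fmorph_eq0.
have [->|b0] := eqVneq b 0.
  by exists 0, 1; rewrite oner_neq0 orbT polyC0 rmorph0 mulr0 mul0r addr0.
have jb0 : j b != 0 by rewrite fmorph_eq0.
pose kappa : {rmorphism k -> Kbar} := j \o (@tofrac {poly k} \o polyC).
have kappa_iota c : kappa (iota c) = j (g c%:P).
  by rewrite /kappa /g /gamma_rat /= map_polyC.
have et : t = j (tofrac 'X) by rewrite /t /gamma_rat /= map_polyX.
have j_tofrac (u : {poly k}) : (map_poly kappa u).[t] = j (tofrac u).
  elim/poly_ind: u => [|u c IHu]; first by rewrite !rmorph0 horner0.
  by rewrite !rmorphD !rmorphM /= map_polyX map_polyC !hornerE IHu et.
have ratl_j x : ratl kappa t (j x).
  have [u [v [v0 ->]]] := fraction_eq x; exists u, v.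
  by rewrite !j_tofrac fmorph_eq0 tofrac_eq0 fmorph_div.
have kt : ~ range kappa t.
  case=> c _; rewrite et /kappa /= => /fmorph_inj/eqP; rewrite tofrac_eq => /eqP ec.
  by have := size_polyX k; rewrite -ec size_polyC; case: (c != 0).
have F_q (c : F) : c ^+ q = c by rewrite -hF expf_card.
have F_char : p \in [pchar F] by apply: card_finPcharP hp; rewrite hF hq.
have E_q : [pchar Kbar].-nat q.
  rewrite (eq_pnat _ (fmorph_pchar (kappa \o iota))) hq pnatX.
  by rewrite pnatE // F_char.
have tors l x : drinfeld_torsion (Phis l) x -> torsion iota kappa t q Q l x.
  move=> [A A0 /eqP Ax]; exists A => //.
  apply: etrans Ax; rewrite (drinfeld_horner (Phis_X l) _ (leqnn _)); apply: eq_bigr => i _.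
  by rewrite kappa_iota.
have [l [ta tb]|d ed] := @common_torsion_dependent F k iota Kbar kappa t q Q q_gt1 le_q2Q
  E_q F_q r erefl kt (j a) (j b) _ hF (ratl_j a) (ratl_j b) ja0 jb0 infS.
  by split; apply: tors.
exists (- d), 1; rewrite oner_neq0 orbT; split=> //.
have -> : b = g d%:P * a.
  by apply: (fmorph_inj j); rewrite ed kappa_iota rmorphM.
by rewrite polyCN rmorphN /= polyC1 rmorph1 mul1r mulNr addNr.
Qed.
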